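(* Let $f$ be a smooth, volume-preserving ($\det Df\equiv 1$) diffeomorphism of a neighborhood of $0$ in $\mathbb{R}^3$, $\xi=(x,y,z)^T$, of the form $f(\xi)=J(\xi+b(\xi))$ with $b(\xi)=O(|\xi|^2)$ and $$Df(0)=J=\begin{pmatrix}1&1&0\\0&1&1\\0&0&1\end{pmatrix}=\mathbb{I}+N .$$ Then for every integer $D\ge2$ there exist a volume-preserving, near-identity change of coordinates $\eta=\psi(\xi)=\xi+h(\xi)$, $h(\xi)=O(|\xi|^2)$, and a polynomial $p$ in two variables with only terms of degree $\ge2$, such that $$\psi\circ f\circ\psi^{-1}(\eta)=g(\eta)+O(|\eta|^{D+1}),\qquad g(\eta)=J\big(\eta+\hat e_3\,p(\eta_1,\eta_2)\big),\quad \hat e_3=(0,0,1)^T.$$ Moreover, for every polynomial $p(x,y)$ (in particular every truncation of the normal form at any degree), the map $g(\xi)=J(\xi+\hat e_3 p(x,y))$ is exactly volume preserving and has a polynomial inverse of the same degree as $g$.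
   Context: $\mathbb{I}$ denotes the $3\times3$ identity matrix and $N$ the $3\times 3$ nilpotent Jordan block with $N_{12}=N_{23}=1$ and all other entries $0$. *)

(* Defs.v *)
From HB Require Import structures.
From mathcomp Require Import all_boot all_order all_algebra.
From mathcomp Require Import all_classical all_reals all_analysis.
From mathcomp Require mpoly.
Set Implicit Arguments. Unset Strict Implicit. Unset Printing Implicit Defensive.
Import Order.TTheory GRing.Theory Num.Theory.
Import numFieldNormedType.Exports.
Local Open Scope classical_set_scope.
Local Open Scope ring_scope.

(* Points of R^3 are column vectors 'cV[R]_3 (with the max norm of
   MathComp-Analysis; all norms on R^3 are equivalent). *)

Section Defs.
Variable R : realType.
Local Notation V := 'cV[R]_3.

Definition ebase (j : 'I_3) : V := delta_mx j 0.
Definition i0 : 'I_3 := @Ordinal 3 0 isT.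
Definition i1 : 'I_3 := @Ordinal 3 1 isT.
Definition i2 : 'I_3 := @Ordinal 3 2 isT.
Definition e3 : V := ebase i2.

Definition Nmat : 'M[R]_3 := \matrix_(i, j) ((j == i.+1 :> nat)%:R).
Definition Jmat : 'M[R]_3 := 1%:M + Nmat.

Definition iter_partial (s : seq 'I_3) (F : V -> V) : V -> V :=
  foldr (fun j G => fun x => 'D_(ebase j) G x) F s.

Definition smooth_on (U : set V) (F : V -> V) : Prop :=
  forall s : seq 'I_3, forall x, U x ->
    {for x, continuous (iter_partial s F)} /\
    forall j, derivable (iter_partial s F) x (ebase j).

Definition Dmat (F : V -> V) (x : V) : 'M[R]_3 :=
  \matrix_(i, j) ('D_(ebase j) F x) i 0.

Definition diffeo_on (U V' : set V) (F Finv : V -> V) : Prop :=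
  [/\ open U, open V', smooth_on U F /\ smooth_on V' Finv,
      (forall x, U x -> V' (F x) /\ Finv (F x) = x) &
      (forall y, V' y -> U (Finv y) /\ F (Finv y) = y)].

Definition local_diffeo0 (F : V -> V) (U : set V) : Prop :=
  U 0 /\ exists (V' : set V) (Finv : V -> V), diffeo_on U V' F Finv.

Definition bigO_at0 (F : V -> V) (k : nat) : Prop :=
  exists C : R, exists2 delta : R, 0 < delta &
    forall x : V, `|x| < delta -> `|F x| <= C * `|x| ^+ k.

Definition peval2 (p : mpoly.mpoly 2 R) (x y : R) : R :=
  mpoly.meval (fun i : 'I_2 => if val i == 0%N then x else y) p.

Definition only_deg_ge2 (p : mpoly.mpoly 2 R) : Prop :=
  forall m : mpoly.multinom 2, (mpoly.mdeg m < 2)%N -> mpoly.mcoeff m p = 0.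

Definition gmap (p : mpoly.mpoly 2 R) (xi : V) : V :=
  Jmat *m (xi + peval2 p (xi i0 0) (xi i1 0) *: e3).

Definition poly_map_rep (q : 'I_3 -> mpoly.mpoly 3 R) (F : V -> V) : Prop :=
  forall xi i, F xi i 0 = mpoly.meval (fun j : 'I_3 => xi j 0) (q i).

Definition pmap_deg (q : 'I_3 -> mpoly.mpoly 3 R) : nat :=
  (\max_(i < 3) \max_(m <- mpoly.msupp (q i)) mpoly.mdeg m)%N.

End Defs.

Arguments Nmat {R}.
Arguments Jmat {R}.
Arguments e3 {R}.

(* Main.v *)
(* Replace f by its Taylor polynomial F of degree D: this costs O(|x|^(D+1)),
   and det Df = 1 becomes det DF = 1 up to terms of order D.  Suppose that,
   after conjugations, F = J (id + e3 p) up to terms of degree d.  The degree d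
   error is J b with b homogeneous, and det DF = 1 forces div b = 0.  A change
   of variables id + h replaces b by b - h + J^-1 (h o J), so one must solve

     h - J^-1 (h o J) = b - q e3,   div h = 0,   q a polynomial in x, y.

   With u the first component of J^-1 (h o J), everything reduces to the scalar
   equation (d_x + d_y D + d_z D^2) u = r, where D = (o J) - 1.  This operator
   maps D^m v to c D^m (d_x v) + D^(m+1) (...) with c > 0, and D is nilpotent on
   homogeneous polynomials, so the operator is onto.

   The field h is then realized exactly by polynomial automorphisms of Jacobian
   one: a divergence-free field is a sum of two planar Hamiltonian fields, and
   powers of linear forms span the Hamiltonians, so that h is a sum of fields
   v q with q invariant along v.  The corresponding maps id + v q are shears
   with inverse id - v q, and a composition of them agrees with id + h up to
   degree d. *)
Require Import Defs.
From HB Require Import structures.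
From mathcomp Require Import all_boot all_order all_algebra.
From mathcomp Require Import all_classical all_reals all_analysis.
From mathcomp Require mpoly.
From mathcomp Require Import ring lra zify.
Import -(notations) mpoly.
Import Order.TTheory GRing.Theory Num.Theory.
Import numFieldNormedType.Exports.
Local Open Scope classical_set_scope.
Local Open Scope ring_scope.
Set Implicit Arguments. Unset Strict Implicit. Unset Printing Implicit Defensive.

Local Notation "p @_ m" := (mcoeff m p) (at level 3, m at level 2, format "p @_ m") :
  ring_scope.
Local Notation "''Y_' i" := (mpolyX _ (mnm1 i)) (at level 8, i at level 2, format "''Y_' i") :
  ring_scope.
Local Notation "'d_ i p" := (mderiv i p) (at level 10, i at level 2, p at level 9, format "''d_' i  p") : ring_scope.

(** * Polynomials with monomials of prescribed degrees *)

Lemma mnm_sub1K {n : nat} (m : multinom n) i : (0 < m i)%N ->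
  m = mnm_add (mnm_sub m (mnm1 i)) (mnm1 i).
Proof.
by move=> mi; apply/mnmP => j; rewrite mnmDE mnmBE mnm1E; case: eqP => [<-|] /=; lia.
Qed.

Lemma mnm_predP {n d : nat} (m : multinom n) : mdeg m = d.+1 ->
  exists2 i, m = mnm_add (mnm_sub m (mnm1 i)) (mnm1 i) & mdeg (mnm_sub m (mnm1 i)) = d.
Proof.
move=> md; have [i mi] : exists i, (0 < m i)%N.
  apply/existsP; rewrite -[X in is_true X]negbK negb_exists; apply/negP => /forallP H.
  by move: md; rewrite mdegE big1 // => i _; have := H i; rewrite -leqNgt leqn0 => /eqP.
exists i; first exact: mnm_sub1K.
by move: md; rewrite {1}(mnm_sub1K mi) mdegD mdeg1 addn1 => -[].
Qed.

Section Support.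
Context {n : nat} {R : comNzRingType}.
Implicit Types p q : mpoly n R.

(** Statements that pass through sums and products, such as the chain rule, reduce to constants and
    variables. *)
Lemma mpoly_ring_ind (P : mpoly n R -> Prop) :
  (forall c, P (mpolyC n c)) -> (forall i, P 'Y_i) ->
  (forall p q, P p -> P q -> P (p + q)) ->
  (forall p q, P p -> P q -> P (p * q)) -> forall p, P p.
Proof.
move=> PC PX PD PM p; rewrite (mpolyE p).
elim/big_ind: _ => [||m _]; [by rewrite -[0]/(mpolyC n 0) // | exact: PD |].
rewrite -mul_mpolyC mpolyXE_id; apply: (PM _ _ (PC _)).
elim/big_ind: _ => [||i _]; [exact: PC | exact: PM |].
by elim: (m i) => [|k IH]; rewrite ?expr0 ?exprS; [exact: PC | exact: PM].
Qed.

(** One predicate on the degrees of the monomials covers order of vanishing, homogeneity and degree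
    bounds, so that closure properties are proved once. The zero polynomial satisfies every
    instance. *)
Definition supported (P : pred nat) p := forall m, m \in msupp p -> P (mdeg m).

Lemma supportedW (P Q : pred nat) p :
  (forall d, P d -> Q d) -> supported P p -> supported Q p.
Proof. by move=> PQ Pp m /Pp /PQ. Qed.

Lemma supported0 P : supported P (0 : mpoly n R).
Proof. by move=> m; rewrite msupp0. Qed.

Lemma supportedD P p q : supported P p -> supported P q -> supported P (p + q).
Proof. by move=> Pp Pq m /msuppD_le; rewrite mem_cat => /orP[/Pp|/Pq]. Qed.

Lemma supportedN P p : supported P p -> supported P (- p).
Proof. by move=> Pp m; rewrite (perm_mem (msuppN p)) => /Pp. Qed.

Lemma supportedB P p q : supported P p -> supported P q -> supported P (p - q).
Proof. by move=> Pp Pq; apply: supportedD => //; apply: supportedN. Qed.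

Lemma supportedZ P c p : supported P p -> supported P (c *: p).
Proof. by move=> Pp m /msuppZ_le /Pp. Qed.

Lemma supportedMn P p k : supported P p -> supported P (p *+ k).
Proof.
move=> Pp; elim: k => [|k IH]; first by rewrite mulr0n; apply: supported0.
by rewrite mulrS; apply: supportedD.
Qed.

Lemma supported_sum P (I : Type) (r : seq I) (Q : pred I) (F : I -> mpoly n R) :
  (forall i, Q i -> supported P (F i)) -> supported P (\sum_(i <- r | Q i) F i).
Proof.
by move=> H; elim/big_ind: _ => //; [apply: supported0 | apply: supportedD].
Qed.

Lemma supportedX (P : pred nat) m : P (mdeg m) -> supported P (mpolyX R m).
Proof. by move=> Pm m'; rewrite msuppX inE => /eqP->. Qed.

Lemma supportedY (P : pred nat) i : P 1%N -> supported P ('Y_i : mpoly n R).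
Proof. by move=> P1; apply: supportedX; rewrite mdeg1. Qed.

Lemma supportedC (P : pred nat) c : P 0%N -> supported P (mpolyC n c : mpoly n R).
Proof. by move=> P0 m; rewrite msuppC; case: eqP => //; rewrite inE => _ /eqP->; rewrite mdeg0. Qed.

Lemma supportedM (P Q S : pred nat) p q :
  (forall a b, P a -> Q b -> S (a + b)%N) ->
  supported P p -> supported Q q -> supported S (p * q).
Proof.
move=> PQS Pp Qq m /msuppM_le /allpairsP[[m1 m2] /= [/Pp H1 /Qq H2 ->]].
by rewrite mdegD; apply: PQS.
Qed.

Lemma supported_mderiv (P Q : pred nat) i p :
  (forall d, P d.+1 -> Q d) -> supported P p -> supported Q ('d_i p).
Proof.
move=> PQ Pp m; rewrite mcoeff_msupp mcoeff_mderiv => H; apply: PQ.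
have := Pp (mnm_add m (mnm1 i)); rewrite mcoeff_msupp mdegD mdeg1 addn1; apply.
by apply: contraNneq H => ->; rewrite mul0rn.
Qed.

Lemma supported_coeff (P : pred nat) p m : supported P p -> ~~ P (mdeg m) -> p@_m = 0.
Proof. by move=> Pp nP; apply/eqP; rewrite mcoeff_eq0; apply: contra nP => /Pp. Qed.

Lemma supported_eq0 (P Q : pred nat) p : supported P p -> supported Q p ->
  (forall d, P d -> Q d -> False) -> p = 0.
Proof.
move=> Pp Qp PQ; apply/mpolyP => m; rewrite mcoeff0; apply/eqP; rewrite mcoeff_eq0.
by apply/negP => mp; apply: (PQ _ (Pp _ mp) (Qp _ mp)).
Qed.

Definition ord k := supported (leq k).
Definition homog d := supported (pred1 d).
Definition degle k := supported (geq k).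

Lemma ordW k l p : (k <= l)%N -> ord l p -> ord k p.
Proof. by move=> kl; apply: supportedW => d; apply: leq_trans. Qed.

Lemma ordM k l p q : ord k p -> ord l q -> ord (k + l) (p * q).
Proof. by apply: supportedM => a b; apply: leq_add. Qed.

Lemma homogM k l p q : homog k p -> homog l q -> homog (k + l) (p * q).
Proof. by apply: supportedM => a b /= /eqP-> /eqP->. Qed.

Lemma homog_ord k p : homog k p -> ord k p.
Proof. by apply: (supportedW (P := pred1 k) (Q := leq k)) => d /= /eqP->. Qed.

Lemma mcoeff_pihomog d p m : (pihomog mdeg d p)@_m = if mdeg m == d then p@_m else 0.
Proof.
rewrite pihomogE raddf_sum /=.
under eq_bigr do rewrite mcoeffZ mcoeffX.
have [mp|mp] := boolP (m \in msupp p); last first.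
  rewrite big1_seq => [|m' /andP[_ m'p]]; first by rewrite (memN_msupp_eq0 mp); case: ifP.
  by case: eqP m'p mp => [->->|]; rewrite ?mulr0.
case: ifP => md.
  rewrite -big_filter (bigD1_seq m) /= ?filter_uniq ?msupp_uniq ?mem_filter ?mp ?andbT //.
  by rewrite eqxx mulr1 big1 ?addr0// => m' /negPf->; rewrite mulr0.
rewrite big1 // => m' /eqP m'd; case: eqP => [m'm|]; rewrite ?mulr0//.
by move: md; rewrite -m'm m'd eqxx.
Qed.

Lemma homog_pihomog d p : homog d (pihomog mdeg d p).
Proof. by move=> m; rewrite mcoeff_msupp mcoeff_pihomog; case: ifP => //; rewrite eqxx. Qed.

Lemma ord_pihomog d p : ord d p -> ord d.+1 (p - pihomog mdeg d p).
Proof.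
move=> dp m; rewrite mcoeff_msupp mcoeffB mcoeff_pihomog.
case: (ltngtP (mdeg m) d) => //= [md|_]; last by rewrite subrr eqxx.
by rewrite subr0 -mcoeff_msupp => /dp; rewrite leqNgt md.
Qed.

Lemma mderivY i j : 'd_i ('Y_j : mpoly n R) = (j == i)%:R.
Proof.
rewrite mderivX mnm1E; case: eqP => [->|]; rewrite ?scale0r // scale1r.
by rewrite -[RHS]mpolyX0; congr mpolyX; apply/mnmP => l; rewrite mnmBE mnm0E subnn.
Qed.

End Support.

(** * Substitution of polynomials and its effect on degrees *)

Section Subst.
Context {R : comNzRingType}.

Definition subst {n k} (G : 'I_n -> mpoly k R) (p : mpoly n R) : mpoly k R :=
  comp_mpoly [tuple G i | i < n] p.

Section Morph.
Context {n k : nat}.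
Implicit Types (G : 'I_n -> mpoly k R) (p q : mpoly n R).

HB.instance Definition _ G := GRing.LRMorphism.copy (subst G) (comp_mpoly [tuple G i | i < n]).

Lemma subst0 G : subst G 0 = 0. Proof. exact: rmorph0. Qed.
Lemma subst1 G : subst G 1 = 1. Proof. exact: rmorph1. Qed.
Lemma substD G : {morph subst G : p q / p + q}. Proof. exact: rmorphD. Qed.
Lemma substB G : {morph subst G : p q / p - q}. Proof. exact: rmorphB. Qed.
Lemma substN G : {morph subst G : p / - p}. Proof. exact: rmorphN. Qed.
Lemma substM G : {morph subst G : p q / p * q}. Proof. exact: rmorphM. Qed.
Lemma substXn G m : {morph subst G : p / p ^+ m}. Proof. exact: rmorphXn. Qed.
Lemma substZ G c : {morph subst G : p / c *: p}. Proof. exact: linearZ. Qed.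
Lemma subst_sum G (I : Type) (r : seq I) (P : pred I) (F : I -> mpoly n R) :
  subst G (\sum_(i <- r | P i) F i) = \sum_(i <- r | P i) subst G (F i).
Proof. exact: rmorph_sum. Qed.

Lemma substY G i : subst G 'Y_i = G i.
Proof. by rewrite /subst comp_mpolyXU -tnth_nth tnth_mktuple. Qed.

Lemma substC G c : subst G (mpolyC n c) = mpolyC k c.
Proof. exact: comp_mpolyC. Qed.

Lemma subst_meval G v p : meval v (subst G p) = meval (fun i => meval v (G i)) p.
Proof. by rewrite /subst comp_mpoly_meval; apply: meval_eq => i; rewrite tnth_mktuple. Qed.

Lemma eq_subst G G' p : G =1 G' -> subst G p = subst G' p.
Proof. by move=> e; rewrite (_ : G = G') //; apply/funext. Qed.

Lemma mderiv_subst i G p :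
  'd_i (subst G p) = \sum_j subst G ('d_j p) * 'd_i (G j).
Proof.
elim/(@mpoly_ring_ind n R): p => [c|j|p q IHp IHq|p q IHp IHq].
- rewrite substC mderivC big1 // => j _.
  by rewrite mderivC rmorph0 mul0r.
- rewrite substY (bigD1 j) //= mderivY eqxx rmorph1 mul1r.
  rewrite big1 ?addr0 // => l lj; rewrite mderivY eq_sym (negPf lj) rmorph0.
  by rewrite mul0r.
- rewrite rmorphD mderivD IHp IHq -big_split /=; apply: eq_bigr => j _.
  by rewrite mderivD rmorphD mulrDl.
- rewrite rmorphM mderivM IHp IHq mulr_suml mulr_sumr -big_split /=; apply: eq_bigr => j _.
  by rewrite mderivM rmorphD !rmorphM /=; ring.
Qed.

(** [Q d] describes the degrees occurring in a product of d factors whose monomials have degrees in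
    [P]. The choices [leq], [geq] and [pred1] of [Q] give the three degree estimates for [subst]. *)
Lemma supported_substX (P : pred nat) (Q : nat -> pred nat) G m :
  Q 0%N 0%N -> (forall d a b, P a -> Q d b -> Q d.+1 (a + b)%N) ->
  (forall i, supported P (G i)) -> supported (Q (mdeg m)) (subst G (mpolyX R m)).
Proof.
move=> Q0 QS HG; move: {2}(mdeg m) (erefl (mdeg m)) => d; elim: d m => [|d IH] m.
  move=> /eqP; rewrite mdeg_eq0 => /eqP->; rewrite mpolyX0 rmorph1 mdeg0.
  by have := supportedC (n := k) (R := R) (c := 1) Q0.
move=> md; have [i em md'] := mnm_predP md.
rewrite {2}em mpolyXD substM substY mulrC md.
apply: supportedM (HG i) _; first by move=> a b; apply: QS.
by rewrite -md'; apply: IH.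
Qed.

End Morph.

Lemma subst_subst {n k l} (G : 'I_n -> mpoly k R) (H : 'I_k -> mpoly l R) p :
  subst H (subst G p) = subst (fun i => subst H (G i)) p.
Proof.
elim/(@mpoly_ring_ind n R): p => [c|j|p q IHp IHq|p q IHp IHq].
- by rewrite !substC.
- by rewrite !substY.
- by rewrite !substD IHp IHq.
- by rewrite !substM IHp IHq.
Qed.

Lemma subst_id {n} (p : mpoly n R) : subst (fun i => 'Y_i) p = p.
Proof. exact: comp_mpoly_id. Qed.

Lemma supported_subst {n k} (P : pred nat) (Q : nat -> pred nat) (S S' : pred nat)
    (G : 'I_n -> mpoly k R) p :
  Q 0%N 0%N -> (forall d a b, P a -> Q d b -> Q d.+1 (a + b)%N) ->
  (forall d a, S d -> Q d a -> S' a) ->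
  (forall i, supported P (G i)) -> supported S p -> supported S' (subst G p).
Proof.
move=> Q0 QS QSS' HG Sp; rewrite (mpolyE p) subst_sum big_seq.
apply: supported_sum => m /Sp Sm; rewrite substZ; apply: supportedZ.
by apply: supportedW (supported_substX Q0 QS HG) => a; apply: QSS'.
Qed.

Section Degrees.
Context {n k : nat}.
Implicit Types (G : 'I_n -> mpoly k R) (p : mpoly n R).

Lemma ord_subst d G p : (forall i, ord 1 (G i)) -> ord d p -> ord d (subst G p).
Proof.
apply: (supported_subst (Q := leq)) => // [e a b /= |e a]; first lia.
by move=> de; apply: leq_trans.
Qed.

Lemma degle_subst d G p : (forall i, degle 1 (G i)) -> degle d p -> degle d (subst G p).
Proof.
apply: (supported_subst (Q := geq)) => // [e a b /= |e a /=]; lia.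
Qed.

Lemma homog_subst d G p : (forall i, homog 1 (G i)) -> homog d p -> homog d (subst G p).
Proof.
apply: (supported_subst (Q := pred1)) => // [e a b /= |e a /=].
  by move=> /eqP-> /eqP->.
by move=> /eqP-> /eqP->.
Qed.

(** A discrete mean value estimate: the factors are exchanged one at a time, each exchange brings a
    factor of order [e], and the other factors, at least [d] of them, have order 1. *)
Lemma ord_substB d e G G' p : (forall i, ord 1 (G i)) -> (forall i, ord 1 (G' i)) ->
  (forall i, ord e (G i - G' i)) -> ord d.+1 p ->
  ord (d + e) (subst G p - subst G' p).
Proof.
move=> HG HG' HB Hp.
(* For the monomial 1 the difference is zero, so the truncated predecessor does no harm there. *)
have mono m : ord (mdeg m + e).-1 (subst G (mpolyX R m) - subst G' (mpolyX R m)).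
  move: {1}(mdeg m) (erefl (mdeg m)) => l; elim: l m => [|l IH] m.
    move=> /esym/eqP; rewrite mdeg_eq0 => /eqP->; rewrite mpolyX0 !subst1 subrr.
    exact: supported0.
  move=> /esym md; have [i em /esym md'] := mnm_predP md; set m' := mnm_sub _ _ in em md'.
  have {}IH := IH _ md'.
  rewrite em mpolyXD !substM !substY mdegD mdeg1 addn1.
  rewrite (_ : _ - _ = (G i - G' i) * subst G (mpolyX R m')
     + G' i * (subst G (mpolyX R m') - subst G' (mpolyX R m'))); last by ring.
  apply: supportedD.
    apply: (@ordW _ _ _ (e + mdeg m')); first lia.
    by apply: ordM => //; apply: ord_subst => //; apply: supportedX => /=.
  apply: (@ordW _ _ _ (1 + (mdeg m' + e).-1)); first lia.
  exact: ordM.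
rewrite (mpolyE p) !subst_sum -sumrB big_seq; apply: supported_sum => m /Hp Hm.
rewrite !substZ -scalerBr; apply: supportedZ; apply: ordW (mono m); lia.
Qed.

End Degrees.

End Subst.

(** * The homological equation *)

Section Antiderivative.
Context {n : nat} {R : numFieldType}.
Implicit Types (p q : mpoly n R) (i k : 'I_n).

(** The antiderivative in variable [i] that vanishes where this variable is zero; the divisions use
    characteristic zero. *)
Definition mint i p : mpoly n R :=
  \sum_(m <- msupp p) (p@_m / (m i).+1%:R) *: mpolyX R (mnm_add m (mnm1 i)).

Lemma mcoeff_mintD i p m : (mint i p)@_(mnm_add m (mnm1 i)) = p@_m / (m i).+1%:R.
Proof.
rewrite raddf_sum /=; under eq_bigr do rewrite mcoeffZ mcoeffX eqm_add2r.
have [mp|mp] := boolP (m \in msupp p); last first.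
  rewrite (memN_msupp_eq0 mp) mul0r big1_seq // => m' /andP[_ m'p].
  by case: eqP m'p mp => [->->|]; rewrite ?mulr0.
rewrite (bigD1_seq m) ?msupp_uniq //= eqxx mulr1 big1 ?addr0// => m' /negPf->.
by rewrite mulr0.
Qed.

Lemma mcoeff_mint0 i p (m : multinom n) : m i = 0%N -> (mint i p)@_m = 0.
Proof.
move=> m0; rewrite raddf_sum /= big1 // => m' _; rewrite mcoeffZ mcoeffX.
case: eqP => [e|]; rewrite ?mulr0//.
by move: m0; rewrite -e mnmDE mnm1E eqxx addn1.
Qed.

Lemma mderiv_mint i p : 'd_i (mint i p) = p.
Proof.
apply/mpolyP => m; rewrite mcoeff_mderiv mcoeff_mintD -(mulr_natr (_ / _)) divfK //.
Qed.

Lemma mderiv_mintC i k p : k != i -> 'd_k (mint i p) = mint i ('d_k p).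
Proof.
move=> ki; apply/mpolyP => m; rewrite mcoeff_mderiv.
have [m0|m0] := posnP (m i).
  by rewrite !mcoeff_mint0 ?mul0rn // mnmDE mnm1E (negPf ki) m0.
rewrite (mnm_sub1K m0).
set m' := mnm_sub _ _; rewrite mcoeff_mintD mcoeff_mderiv.
have -> : mnm_add (mnm_add m' (mnm1 i)) (mnm1 k) = mnm_add (mnm_add m' (mnm1 k)) (mnm1 i).
  by apply/mnmP => j; rewrite !mnmDE; lia.
rewrite mcoeff_mintD !mnmDE !mnm1E (negPf ki) (eq_sym i k) (negPf ki) !addn0.
by rewrite -[LHS]mulr_natr -(mulr_natr p@_ _); ring.
Qed.

Lemma homog_mint d i p : homog d p -> homog d.+1 (mint i p).
Proof.
move=> Hp; rewrite /mint big_seq; apply: supported_sum => m /Hp /eqP md.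
by apply: supportedZ; apply: supportedX; rewrite /= mdegD mdeg1 md addn1.
Qed.

Lemma mderiv_homog d i p : homog d.+1 p -> homog d ('d_i p).
Proof. by apply: supported_mderiv => e /=; rewrite eqSS. Qed.

Lemma mderiv_ord d i p : ord d.+1 p -> ord d ('d_i p).
Proof. exact: supported_mderiv. Qed.

End Antiderivative.

Lemma forall_ord3 (P : 'I_3 -> Prop) : P i0 -> P i1 -> P i2 -> forall i, P i.
Proof.
move=> P0 P1 P2 [[|[|[|//]]] lt3].
- by rewrite (_ : Ordinal _ = i0) //; apply: val_inj.
- by rewrite (_ : Ordinal _ = i1) //; apply: val_inj.
- by rewrite (_ : Ordinal _ = i2) //; apply: val_inj.
Qed.

Lemma big_ord3 (T : Type) (idx : T) (op : Monoid.law idx) (F : 'I_3 -> T) :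
  \big[op/idx]_i F i = op (op (F i0) (F i1)) (F i2).
Proof.
rewrite !big_ord_recl big_ord0 Monoid.mulm1 Monoid.mulmA.
by congr (op (op (F _) (F _)) (F _)); apply: val_inj.
Qed.

Lemma sum_ord3 (V : nmodType) (F : 'I_3 -> V) : \sum_i F i = F i0 + F i1 + F i2.
Proof. exact: big_ord3. Qed.

Definition tri {T : Type} (a b c : T) (i : 'I_3) : T :=
  match val i with 0 => a | 1 => b | _ => c end%N.

Lemma triE {T : Type} (a b c : T) :
  (tri a b c i0 = a) * (tri a b c i1 = b) * (tri a b c i2 = c).
Proof. by []. Qed.

Section Homological.
Context {R : numFieldType}.
Local Notation A := (mpoly 3 R).
Implicit Types (p q u r : A) (h b : 'I_3 -> A).

(** The coordinates of J, followed by those of its inverse I - N + N^2; [subst Jpol p] is p o J. *)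
Definition Jpol : 'I_3 -> A := tri ('Y_i0 + 'Y_i1) ('Y_i1 + 'Y_i2) 'Y_i2.
Definition Jpolinv : 'I_3 -> A := tri ('Y_i0 - 'Y_i1 + 'Y_i2) ('Y_i1 - 'Y_i2) 'Y_i2.
Local Notation sg := (subst Jpol).
Local Notation tau := (subst Jpolinv).

Lemma homog_Jpol i : homog 1 (Jpol i).
Proof. by elim/forall_ord3: i; rewrite /Jpol triE; do ?apply: supportedD; apply: supportedY. Qed.

Lemma homog_Jpolinv i : homog 1 (Jpolinv i).
Proof.
by elim/forall_ord3: i; rewrite /Jpolinv triE; do ?[apply: supportedD|apply: supportedN]; apply: supportedY.
Qed.

Lemma sg_tau p : sg (tau p) = p.
Proof.
rewrite subst_subst -[RHS]subst_id; apply: eq_subst => i.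
by elim/forall_ord3: i; rewrite /Jpol /Jpolinv !triE !(substD, substN, substY) ?triE; ring.
Qed.

Lemma tau_sg p : tau (sg p) = p.
Proof.
rewrite subst_subst -[RHS]subst_id; apply: eq_subst => i.
by elim/forall_ord3: i; rewrite /Jpol /Jpolinv !triE !(substD, substN, substY) ?triE; ring.
Qed.

Lemma mderiv0_sg p : 'd_i0 (sg p) = sg ('d_i0 p).
Proof. by rewrite mderiv_subst sum_ord3 /Jpol /Jpolinv !triE !mderivD !mderivY /=; ring. Qed.

Lemma mderiv1_sg p : 'd_i1 (sg p) = sg ('d_i0 p) + sg ('d_i1 p).
Proof. by rewrite mderiv_subst sum_ord3 /Jpol /Jpolinv !triE !mderivD !mderivY /=; ring. Qed.

Lemma mderiv2_sg p : 'd_i2 (sg p) = sg ('d_i1 p) + sg ('d_i2 p).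
Proof. by rewrite mderiv_subst sum_ord3 /Jpol /Jpolinv !triE !mderivD !mderivY /=; ring. Qed.

Lemma mderiv0_tau p : 'd_i0 (tau p) = tau ('d_i0 p).
Proof. by rewrite mderiv_subst sum_ord3 /Jpol /Jpolinv !triE !(mderivD, mderivN) !mderivY /=; ring. Qed.

Lemma mderiv1_tau p : 'd_i1 (tau p) = tau ('d_i1 p) - tau ('d_i0 p).
Proof. by rewrite mderiv_subst sum_ord3 /Jpol /Jpolinv !triE !(mderivD, mderivN) !mderivY /=; ring. Qed.

Lemma mderiv2_tau p : 'd_i2 (tau p) = tau ('d_i2 p) - tau ('d_i1 p) + tau ('d_i0 p).
Proof. by rewrite mderiv_subst sum_ord3 /Jpol /Jpolinv !triE !(mderivD, mderivN) !mderivY /=; ring. Qed.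

Fact Dl_key : unit. Proof. by []. Qed.
(* Locked, since unification would otherwise expose the subtraction in
   [Dl m.+1 p] when rewriting with additivity. *)
Definition Dl : nat -> A -> A :=
  locked_with Dl_key (fun m p => iter m (fun q => sg q - q) p).

Lemma DlE m p : Dl m p = iter m (fun q => sg q - q) p.
Proof. by rewrite /Dl unlock. Qed.

Lemma Dl_id p : Dl 0 p = p. Proof. by rewrite DlE. Qed.

Lemma DlS m p : Dl m.+1 p = sg (Dl m p) - Dl m p. Proof. by rewrite !DlE. Qed.

Lemma Dl1 p : Dl 1 p = sg p - p. Proof. by rewrite DlE. Qed.

Lemma Dl_add (a b : nat) p : Dl (a + b) p = Dl a (Dl b p). Proof. by rewrite !DlE iterD. Qed.

Lemma DlD m : {morph Dl m : p q / p + q}.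
Proof. by move=> p q; elim: m => [|m IH]; rewrite ?Dl_id // !DlS IH substD; ring. Qed.

Lemma Dl0 m : Dl m 0 = 0.
Proof. by elim: m => [|m IH]; rewrite ?Dl_id // DlS IH subst0 subrr. Qed.

Lemma DlZ m c : {morph Dl m : p / c *: p}.
Proof. by move=> p; elim: m => [|m IH]; rewrite ?Dl_id // !DlS IH substZ scalerBr. Qed.

Lemma DlMn m k : {morph Dl m : p / p *+ k}.
Proof. by move=> p; rewrite -scaler_nat DlZ scaler_nat. Qed.

Lemma homog_Dl d m p : homog d p -> homog d (Dl m p).
Proof.
move=> Hp; elim: m => [|m IH]; rewrite ?Dl_id // DlS; apply: supportedB => //.
by apply: homog_subst => //; apply: homog_Jpol.
Qed.

(** D is a twisted derivation, D (p q) = (D p) q + p (D q) + (D p) (D q), and each of the three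
    terms has a smaller total nilpotency index. *)
Lemma Dl_nilM (a b : nat) p q : Dl a.+1 p = 0 -> Dl b.+1 q = 0 -> Dl (a + b).+1 (p * q) = 0.
Proof.
move: {-1}(a + b)%N (leqnn (a + b)%N) => s; elim: s a b p q => [|s IH] a b p q.
  rewrite leqn0 addn_eq0 => /andP[/eqP-> /eqP->]; rewrite !Dl1 substM.
  by move=> /subr0_eq-> /subr0_eq->; rewrite subrr.
move=> abs Hp Hq; rewrite (_ : Dl s.+2 _ = Dl s.+1 (Dl 1 (p * q))); last by rewrite -Dl_add addn1.
have -> : Dl 1 (p * q) = Dl 1 p * q + p * Dl 1 q + Dl 1 p * Dl 1 q.
  by rewrite !Dl1 substM; ring.
(* Applying D lowers the index by one; at index 0 the predecessor truncates, but then D r is already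
   zero. *)
have nil1 c r : Dl c.+1 r = 0 -> Dl c.-1.+1 (Dl 1 r) = 0 /\ (c = 0%N -> Dl 1 r = 0).
  move=> Hr; split=> [|c0]; last by rewrite c0 in Hr.
  case: c Hr => [|c] Hr; last by rewrite -Dl_add addn1.
  by rewrite (_ : Dl 1 r = 0) ?Dl0.
have [Hp' p0] := nil1 _ _ Hp; have [Hq' q0] := nil1 _ _ Hq.
have Ep : Dl s.+1 (Dl 1 p * q) = 0.
  have [/p0->|a0] := posnP a; first by rewrite mul0r Dl0.
  by apply: (IH a.-1 b) => //; lia.
have Eq : Dl s.+1 (p * Dl 1 q) = 0.
  have [/q0->|b0] := posnP b; first by rewrite mulr0 Dl0.
  by apply: (IH a b.-1) => //; lia.
have Epq : Dl s.+1 (Dl 1 p * Dl 1 q) = 0.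
  have [/p0->|a0] := posnP a; first by rewrite mul0r Dl0.
  by apply: (IH a.-1 b.-1) => //; lia.
by rewrite !DlD Ep Eq Epq !addr0.
Qed.

Lemma Dl_nilX m : Dl (mdeg m).*2.+1 (mpolyX R m) = 0.
Proof.
rewrite mpolyXE_id mdegE -muln2 big_distrl /=.
(* D sends x to y, y to z and z to 0, so D^3 kills each variable, and by [Dl_nilM] a monomial of
   degree d is killed by D^(2 d + 1). *)
have HY i : Dl 3 ('Y_i : A) = 0.
  by elim/forall_ord3: i;
     rewrite !DlE /Jpol /= !(substD, substN, substY, triE); ring.
elim/big_rec2: _ => [|i d p _ IH].
  by rewrite Dl1 subst1 subrr.
apply: Dl_nilM IH; elim: (m i) => [|k IH]; first by rewrite expr0 Dl1 subst1 subrr.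
by rewrite exprS mulSn; apply: Dl_nilM.
Qed.

Lemma Dl_nil d p : homog d p -> Dl d.*2.+1 p = 0.
Proof.
move=> Hp; rewrite (mpolyE p) big_seq; elim/big_rec: _ => [|m q /Hp /eqP md IH].
  exact: Dl0.
by rewrite DlD DlZ -md Dl_nilX md IH scaler0 addr0.
Qed.

(** The divergence of (u, D u, D^2 u), which is the operator of the scalar equation. *)
Definition divtri u : A := 'd_i0 u + 'd_i1 (Dl 1 u) + 'd_i2 (Dl 2 u).

Lemma mderiv0_Dl m u : 'd_i0 (Dl m u) = Dl m ('d_i0 u).
Proof. by elim: m => [|m IH]; rewrite ?Dl_id // !DlS mderivB mderiv0_sg IH. Qed.

Lemma mderiv1_DlS v : 'd_i1 (Dl 1 v) = Dl 1 ('d_i1 v) + 'd_i0 v + Dl 1 ('d_i0 v).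
Proof. by rewrite !Dl1 mderivB mderiv1_sg; ring. Qed.

Lemma mderiv2_DlS v : 'd_i2 (Dl 1 v) = Dl 1 ('d_i2 v) + 'd_i1 v + Dl 1 ('d_i1 v).
Proof. by rewrite !Dl1 mderivB mderiv2_sg; ring. Qed.

(** Passing ['d_i1] over one factor D gives d_y D = D d_y + d_x + D d_x. Since d_x commutes with D,
    the m + 1 factors release m + 1 copies of D^m d_x, and all else carries D^(m+1). *)
Lemma mderiv1_Dl d m u : homog d.+1 u ->
  exists2 r, homog d r & 'd_i1 (Dl m.+1 u) = Dl m ('d_i0 u *+ m.+1) + Dl m.+1 r.
Proof.
move=> Hu; elim: m => [|m [r Hr IH]].
  exists ('d_i1 u + 'd_i0 u); first by apply: supportedD; apply: mderiv_homog.
  by rewrite mderiv1_DlS DlD !Dl_id; ring.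
exists (r + 'd_i0 u); first by apply: supportedD => //; apply: mderiv_homog.
rewrite (_ : Dl m.+2 u = Dl 1 (Dl m.+1 u)); last by rewrite -Dl_add.
rewrite mderiv1_DlS IH mderiv0_Dl !DlD -!Dl_add !add1n !DlMn.
ring.
Qed.

(** Passing ['d_i2] over one D releases ['d_i1], which in turn releases ['d_i0] from the remaining
    factors. The count [k] is bound before [u] because the choice of [u] in [divtri_onto] depends on
    it. *)
Lemma mderiv2_Dl m : exists k : nat, forall d u, homog d.+1 u ->
  exists2 r, homog d r & 'd_i2 (Dl m.+2 u) = Dl m ('d_i0 u *+ k) + Dl m.+1 r.
Proof.
elim: m => [|m [k IH]].
  exists 1%N => d u Hu.
  have H i : homog d ('d_i u) by apply: mderiv_homog.
  exists (Dl 1 ('d_i2 u) + 'd_i1 u *+ 2 + Dl 1 ('d_i1 u) *+ 2 + 'd_i0 u *+ 2 + Dl 1 ('d_i0 u)).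
    by repeat first [exact: H | apply: homog_Dl | apply: supportedMn | apply: supportedD].
  rewrite -[2%N]/(1 + 1)%N Dl_add mderiv2_DlS mderiv2_DlS mderiv1_DlS.
  by rewrite !DlD !DlMn -!Dl_add !Dl_id; ring.
exists (k + m.+2)%N => d u Hu; have [r Hr E] := IH d u Hu.
have [s Hs F] := mderiv1_Dl m.+1 Hu.
exists (r + s + 'd_i0 u *+ m.+2 + Dl 1 s).
  apply: supportedD; last exact: homog_Dl.
  apply: supportedD; first exact: supportedD.
  by apply: supportedMn; apply: mderiv_homog.
rewrite (_ : Dl m.+3 u = Dl 1 (Dl m.+2 u)); last by rewrite -Dl_add.
rewrite mderiv2_DlS E F mulrnDr !DlD -!Dl_add !add1n addn1.
by ring.
Qed.

(** The three derivatives contribute 1, m + 1 and a natural number of copies of D^m d_x, so no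
    cancellation is possible. *)
Lemma divtri_Dl m : exists2 k : nat, (0 < k)%N & forall d u, homog d.+1 u ->
  exists2 r, homog d r & divtri (Dl m u) = Dl m ('d_i0 u *+ k) + Dl m.+1 r.
Proof.
have [k Hk] := mderiv2_Dl m.
exists (m.+2 + k)%N => // d u Hu; have [r Hr E] := Hk d u Hu.
have [s Hs F] := mderiv1_Dl m Hu.
exists (r + s); first exact: supportedD.
rewrite /divtri -!Dl_add !add1n add2n E F mderiv0_Dl mulrnDr (mulrS _ m.+1) !DlD.
by ring.
Qed.

Lemma divtriD : {morph divtri : u v / u + v}.
Proof. by move=> u v; rewrite /divtri !DlD !mderivD; ring. Qed.

(* Modulo the image of [Dl m.+1], [divtri] acts on the image of [Dl m] as a
   positive multiple of the surjective operator ['d_i0]; [Dl] being nilpotent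
   in each degree, the equation is solved by successive approximation. *)
Lemma divtri_onto d r : homog d r -> exists2 u, homog d.+1 u & divtri u = r.
Proof.
(* [k] bounds the number of corrections left: once [m] reaches 2 d + 1, D^m q is zero. *)
suff H k m q : (d.*2.+1 <= m + k)%N -> homog d q ->
    exists2 u, homog d.+1 u & divtri u = Dl m q.
  by move=> /(H d.*2.+1 0%N); rewrite Dl_id; apply.
elim: k m q => [|k IH] m q mk Hq.
  exists 0; first exact: supported0.
  rewrite addn0 in mk.
  by rewrite /divtri !Dl0 !raddf0 !addr0 -(subnK mk) Dl_add Dl_nil // Dl0.
have [c c0 Hc] := divtri_Dl m.
have Hu : homog d.+1 (c%:R^-1 *: mint i0 q) by apply: supportedZ; apply: homog_mint.
have [s Hs E] := Hc d _ Hu.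
have [||v Hv F] := IH m.+1 (- s); [lia | exact: supportedN |].
exists (Dl m (c%:R^-1 *: mint i0 q) + v).
  by apply: supportedD => //; apply: homog_Dl.
rewrite divtriD E F mderivZ mderiv_mint -scaler_nat scalerA mulfV ?pnatr_eq0 -?lt0n //.
by rewrite scale1r -scaleN1r DlZ scaleN1r addrK.
Qed.

Definition divg h : A := 'd_i0 (h i0) + 'd_i1 (h i1) + 'd_i2 (h i2).

(** J acts here on the values of a field, whereas [subst Jpol] acts on its argument. *)
Definition Jvec h : 'I_3 -> A := tri (h i0 + h i1) (h i1 + h i2) (h i2).
Definition Jvecinv h : 'I_3 -> A := tri (h i0 - h i1 + h i2) (h i1 - h i2) (h i2).

Lemma JvecK h : Jvecinv (Jvec h) =1 h.
Proof. by move=> i; elim/forall_ord3: i; rewrite /Jvec /Jvecinv !triE; ring. Qed.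

Lemma JvecinvK h : Jvec (Jvecinv h) =1 h.
Proof. by move=> i; elim/forall_ord3: i; rewrite /Jvec /Jvecinv !triE; ring. Qed.

(** The field is the conjugate of [h] by J, and the trace of a derivative is invariant under
    conjugation. *)
Lemma divg_Jtau h : divg (Jvec (fun i => tau (h i))) = tau (divg h).
Proof.
rewrite /divg /Jvec !triE !mderivD !substD !(mderiv0_tau, mderiv1_tau, mderiv2_tau).
by do !move: (tau _) => ?; ring.
Qed.

(* In terms of [k = J^-1 (h o J)] the equation is [J (k o J^-1) - k = b - q e3];
   its first two components give [k i1] and [k i2] from [u = k i0], and
   [divg k = 0] becomes an equation [divtri u = ...]. *)
Lemma homological d b : homog d.+1 (b i0) -> homog d.+1 (b i1) -> homog d.+1 (b i2) ->
  divg b = 0 ->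
  exists h q, [/\ forall i, homog d.+1 (h i), divg h = 0,
    homog d.+1 q, 'd_i2 q = 0 &
    forall i, h i - Jvecinv (fun j => sg (h j)) i = b i - tri 0 0 q i].
Proof.
move=> b0 b1 b2 divb.
have Hs p : homog d.+1 p -> homog d.+1 (sg p).
  by apply: homog_subst; apply: homog_Jpol.
have Ht p : homog d.+1 p -> homog d.+1 (tau p).
  by apply: homog_subst; apply: homog_Jpolinv.
(* Composed with J, the first two components read k_1 = b_0 o J + D u and k_2 = b_1 o J + D k_1;
   [c1] and [c2] collect what does not involve [u]. *)
pose c1 := sg (b i0); pose c2 := sg (b i1) + Dl 1 c1.
have Hc1 : homog d.+1 c1 by apply: Hs.
have Hc2 : homog d.+1 c2 by apply: supportedD; [apply: Hs | apply: homog_Dl].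
have [|u Hu Eu] := @divtri_onto d (- ('d_i1 c1 + 'd_i2 c2)).
  by apply: supportedN; apply: supportedD; apply: mderiv_homog.
pose k1 := c1 + Dl 1 u; pose k2 := c2 + Dl 2 u.
pose k : 'I_3 -> A := tri u k1 k2.
have Hk1 : homog d.+1 k1 by apply: supportedD => //; apply: homog_Dl.
have Hk2 : homog d.+1 k2 by apply: supportedD => //; apply: homog_Dl.
have divk : divg k = 0.
  rewrite /divg /k !triE /k1 /k2 (mderivD i1 c1) (mderivD i2 c2).
  transitivity (divtri u + ('d_i1 c1 + 'd_i2 c2)); first by rewrite /divtri; ring.
  by rewrite Eu addNr.
have [h Eh] : exists h, h = Jvec (fun i => tau (k i)) by eexists.
have tDl1 p : tau (Dl 1 p) = p - tau p by rewrite Dl1 substB tau_sg.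
have tDl2 p : tau (Dl 2 p) = Dl 1 p - tau (Dl 1 p) by rewrite -[2%N]/(1 + 1)%N Dl_add tDl1.
(* The third component of the equation serves as the definition of [q]. *)
have [q Eq] : exists q, q = b i2 - (tau k2 - k2) by eexists.
have E i : h i - k i = b i - tri 0 0 q i.
  elim/forall_ord3: i; rewrite Eh /Jvec /k !triE.
  - by rewrite /k1 substD tDl1 /c1 tau_sg; ring.
  - by rewrite /k2 /k1 /c2 !substD !tDl2 !tDl1 /c1 !tau_sg; ring.
  - by rewrite Eq; ring.
have divh : divg h = 0 by rewrite Eh divg_Jtau divk subst0.
exists h, q; split => //.
- by move=> i; elim/forall_ord3: i; rewrite Eh /Jvec triE; do ?apply: supportedD; apply: Ht; rewrite /k triE.
- by rewrite Eq; exact: (supportedB b2 (supportedB (Ht _ Hk2) Hk2)).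
(* Taking divergences in h - k = b - q e3, where h, k and b are divergence free, leaves d_z q =
   0. *)
- have : divg (fun i => h i - k i) = divg (fun i => b i - tri 0 0 q i).
    by congr divg; apply/funext.
  move: divh divk divb; rewrite /divg; move: h k {E Eh} => h k.
  rewrite !mderivB !triE !mderiv0 !subr0 => divh divk divb F.
  rewrite -[LHS](subKr ('d_i2 (b i2))) -(addKr ('d_i0 (b i0) + 'd_i1 (b i1)) (_ - 'd_i2 q)) -F.
  rewrite (_ : _ - _ = ('d_i0 (b i0) + 'd_i1 (b i1) + 'd_i2 (b i2)) -
    ('d_i0 (h i0) + 'd_i1 (h i1) + 'd_i2 (h i2)) + ('d_i0 (k i0) + 'd_i1 (k i1) + 'd_i2 (k i2))).
    by rewrite divh divk divb subr0 addr0.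
  by move: ('d__ _) ('d__ _) ('d__ _) ('d__ _) ('d__ _) ('d__ _) ('d__ _) ('d__ _) ('d__ _) => *; ring.
- move=> i; rewrite -E; congr (_ - _); rewrite -[RHS]JvecK.
  congr Jvecinv; apply/funext => j; rewrite Eh.
  by elim/forall_ord3: j; rewrite /Jvec !triE ?substD !sg_tau.
Qed.

End Homological.

(** * Realization of divergence-free fields by shears *)

(** When w u = 0, both products of triangular block matrices equal the matrix with block rows (1,
    -w) and (u, 1); comparing determinants gives the claim. *)
Lemma det_1D_rank1 (R : comNzRingType) n (u : 'cV[R]_n) (w : 'rV[R]_n) :
  w *m u = 0 -> \det (1%:M + u *m w) = 1.
Proof.
move=> wu; have := congr1 determinant (_ : block_mx 1%:M 0 u 1%:M *m
  block_mx 1%:M (- w) 0 (1%:M + u *m w) = block_mx 1%:M (- w) 0 1%:M *m block_mx 1%:M 0 u 1%:M).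
rewrite !det_mulmx !det_lblock !det_ublock !det1 !mul1r; apply.
rewrite !mulmx_block !mulmx1 !mul1mx !mulmx0 !mul0mx !addr0 !add0r.
by rewrite mulNmx wu oppr0 addr0 mulmxN addrCA addNr addr0.
Qed.

(** In the expansion of (x + t y)^n the term x^(n-j) y^j carries t^j. The values t = 0, ..., n are
    distinct, so inverting their Vandermonde matrix isolates j = b. *)
Lemma power_span (R : numFieldType) n b : (b <= n)%N ->
  exists c : 'I_n.+1 -> R, forall (A : comAlgType R) (x y : A),
    \sum_t c t *: (x + (t%:R : R) *: y) ^+ n = x ^+ (n - b) * y ^+ b.
Proof.
move=> bn; pose a : 'rV[R]_n.+1 := \row_t t%:R.
have Vu : Vandermonde n.+1 a \in unitmx.
  rewrite unitmxE det_Vandermonde unitfE; apply/prodf_neq0 => i _; apply/prodf_neq0 => j ij.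
  by rewrite !mxE subr_eq0 eqr_nat eq_sym neq_ltn ij.
pose c := invmx (Vandermonde n.+1 a) *m delta_mx (inord b) (0 : 'I_1).
have Ec (j : 'I_n.+1) : \sum_t c t 0 * (t%:R : R) ^+ j = (j == inord b)%:R.
  have := congr1 (fun M : 'cV[R]_n.+1 => M j 0) (mulKVmx Vu (delta_mx (inord b) (0 : 'I_1))).
  rewrite !mxE andbT => <-; apply: eq_bigr => t _.
  by rewrite !mxE mulrC.
exists (fun t => ('C(n, b))%:R^-1 * c t 0) => A x y.
under eq_bigr do rewrite exprDn scaler_sumr.
rewrite exchange_big /= (bigD1 (inord b)) //= [X in _ + X]big1 => [|j jb].
  rewrite addr0 inordK //.
  transitivity (\sum_(t < n.+1) (c t 0 * (t%:R : R) ^+ b) *: (x ^+ (n - b) * y ^+ b)).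
    apply: eq_bigr => t _; rewrite exprZn -scalerAr scalerMnl scalerA; congr (_ *: _).
    by rewrite -mulr_natr; field; rewrite pnatr_eq0 -lt0n bin_gt0.
  rewrite -scaler_suml; have := Ec (inord b); rewrite inordK // eqxx => ->.
  exact: scale1r.
transitivity (\sum_(t < n.+1) (c t 0 * (t%:R : R) ^+ j) *: (('C(n, b))%:R^-1 *: (x ^+ (n - j) * y ^+ j *+ 'C(n, j)))).
  by apply: eq_bigr => t _; rewrite exprZn -scalerAr !scalerMnr !scalerA; congr (_ *: _); ring.
by rewrite -scaler_suml Ec (negPf jb) scale0r.
Qed.

Section Automorphisms.
Context {R : numFieldType}.
Local Notation A := (mpoly 3 R).
Implicit Types (p q s : A) (h F G P Q : 'I_3 -> A).

Definition pcomp F G : 'I_3 -> A := fun i => subst G (F i).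
Definition pid : 'I_3 -> A := fun i => 'Y_i.
Definition jac F : 'M[A]_3 := \matrix_(i, j) 'd_j (F i).

Lemma jac_comp F G : jac (pcomp F G) = map_mx (subst G) (jac F) *m jac G.
Proof.
apply/matrixP => i j; rewrite !mxE mderiv_subst; apply: eq_bigr => k _.
by rewrite !mxE.
Qed.

Lemma det_jac_comp F G : \det (jac (pcomp F G)) = subst G (\det (jac F)) * \det (jac G).
Proof. by rewrite jac_comp det_mulmx -det_map_mx. Qed.

Lemma jac_pid : jac pid = 1%:M.
Proof. by apply/matrixP => i j; rewrite !mxE mderivY. Qed.

Lemma pcompA F G P : pcomp F (pcomp G P) = pcomp (pcomp F G) P.
Proof. by apply/funext => i; rewrite /pcomp subst_subst. Qed.

Lemma pcomp_id F : pcomp F pid = F.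
Proof. by apply/funext => i; apply: subst_id. Qed.

Lemma pcomp_idl F : pcomp pid F = F.
Proof. by apply/funext => i; apply: substY. Qed.

Definition vol_aut P Q :=
  [/\ pcomp P Q = pid, pcomp Q P = pid & \det (jac P) = 1].

Lemma vol_aut_comp P Q P' Q' : vol_aut P Q -> vol_aut P' Q' ->
  vol_aut (pcomp P P') (pcomp Q' Q).
Proof.
move=> [PQ QP dP] [PQ' QP' dP']; split.
- by rewrite -pcompA (pcompA P') PQ' pcomp_idl.
- by rewrite -pcompA (pcompA Q) QP pcomp_idl.
- by rewrite det_jac_comp dP subst1 dP' mulr1.
Qed.

Lemma vol_aut_id : vol_aut pid pid.
Proof. by split; rewrite ?jac_pid ?det1 ?pcomp_id. Qed.

Lemma vol_aut_det_inv P Q : vol_aut P Q -> \det (jac Q) = 1.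
Proof.
move=> [PQ _ dP]; have := det_jac_comp P Q.
by rewrite PQ jac_pid det1 dP subst1 mul1r.
Qed.

(** An automorphism of Jacobian one agrees with id + h up to degree [d]. The expansion of the
    inverse is recorded too, since conjugation uses both. *)
Definition realizes d h := exists P Q, [/\ vol_aut P Q,
  forall i, ord d.+1 (P i - 'Y_i - h i) & forall i, ord d.+1 (Q i - 'Y_i + h i)].

Lemma ord1Y i : ord 1 ('Y_i : A). Proof. exact: supportedY. Qed.

Lemma realizes_ord1 d h F : (forall i, ord d.+1 (h i)) ->
  (forall i, ord d.+2 (F i - 'Y_i - h i)) -> forall i, ord 1 (F i).
Proof.
move=> Hh HF i; rewrite (_ : F i = (F i - 'Y_i - h i) + 'Y_i + h i); last by ring.
apply: supportedD; last exact: ordW (Hh i).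
by apply: supportedD; [apply: ordW (HF i) | apply: ord1Y].
Qed.

(** The cross term h o P' - h has order (d - 1) + d, which exceeds d because d > 1; so up to degree
    d the fields add. *)
Lemma near_id_comp d h h' P P' : (1 < d)%N -> (forall i, ord d (h i)) ->
  (forall i, ord d (h' i)) ->
  (forall i, ord d.+1 (P i - 'Y_i - h i)) -> (forall i, ord d.+1 (P' i - 'Y_i - h' i)) ->
  forall i, ord d.+1 (pcomp P P' i - 'Y_i - (h i + h' i)).
Proof.
case: d => // d d1 Hh Hh' HP HP' i.
have HP'1 := realizes_ord1 Hh' HP'.
have -> : pcomp P P' i - 'Y_i - (h i + h' i) = (P' i - 'Y_i - h' i)
    + (subst P' (h i) - subst pid (h i)) + subst P' (P i - 'Y_i - h i).
  by rewrite !substB substY subst_id /pcomp; ring.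
apply: supportedD; last exact: ord_subst.
apply: supportedD; first exact: HP'.
apply: (@ordW _ _ _ (d + d.+1)); first lia.
apply: ord_substB => // [j|j]; first exact: ord1Y.
rewrite (_ : P' j - pid j = (P' j - 'Y_j - h' j) + h' j); last by rewrite /pid; ring.
by apply: supportedD; [apply: ordW (HP' j) | apply: Hh'].
Qed.

Lemma realizesD d h h' : (1 < d)%N -> (forall i, ord d (h i)) -> (forall i, ord d (h' i)) ->
  realizes d h -> realizes d h' -> realizes d (fun i => h i + h' i).
Proof.
move=> d1 Hh Hh' [P [Q [PQ HP HQ]]] [P' [Q' [PQ' HP' HQ']]].
exists (pcomp P P'), (pcomp Q' Q); split; first exact: vol_aut_comp.
  exact: near_id_comp.
move=> i; rewrite -[h i + h' i]opprK opprD addrC.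
rewrite (_ : - _ + _ = pcomp Q' Q i - 'Y_i - (- h' i + - h i)); last by ring.
apply: (@near_id_comp d (fun i => - h' i) (fun i => - h i) Q' Q d1) => j;
  by rewrite /= ?opprK; first [exact: HQ' | exact: HQ | exact: supportedN (Hh j) | exact: supportedN (Hh' j)].
Qed.

Lemma realizes0 d : realizes d (fun=> 0).
Proof.
exists pid, pid; split; first exact: vol_aut_id.
  by move=> i; rewrite subrr subr0; apply: supported0.
by move=> i; rewrite subrr addr0; apply: supported0.
Qed.

Lemma realizes_sum d (I : Type) (r : seq I) (F : I -> 'I_3 -> A) : (1 < d)%N ->
  (forall x i, ord d (F x i)) -> (forall x, realizes d (F x)) ->
  realizes d (fun i => \sum_(x <- r) F x i).
Proof.
move=> d1 HF RF; elim: r => [|x r IH].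
  by rewrite (_ : (fun _ => _) = fun=> 0); [apply: realizes0 | apply/funext => i; rewrite big_nil].
rewrite (_ : (fun _ => _) = fun i => F x i + \sum_(y <- r) F y i).
  refine (realizesD d1 (HF x) _ (RF x) IH).
  by move=> i; apply: supported_sum => y _; apply: HF.
by apply/funext => i; rewrite big_cons.
Qed.

(** As q is constant along v, the maps id + t q v form a one-parameter group, and t = -1 inverts t =
    1. The Jacobian matrix is I + v dq with dq(v) = 0, to which [det_1D_rank1] applies. *)
Lemma realizes_shear d q (v : 'I_3 -> R) :
  (forall t, subst (fun i => 'Y_i + (t * v i) *: q) q = q) ->
  \sum_i v i *: 'd_i q = 0 -> realizes d (fun i => v i *: q).
Proof.
move=> Hq Dq; pose S t : 'I_3 -> A := fun i => 'Y_i + (t * v i) *: q.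
have SS t t' : t + t' = 0 -> pcomp (S t) (S t') = pid.
  move=> tt'; apply/funext => i; rewrite /pcomp /S substD substZ substY Hq /pid -addrA -scalerDl -mulrDl.
  by rewrite [t' + t]addrC tt' mul0r scale0r addr0.
exists (S 1), (S (- 1)); split.
- split; [by apply: SS; rewrite subrr | by apply: SS; rewrite addNr |].
  rewrite (_ : jac _ = 1%:M + (\col_i mpolyC 3 (v i)) *m (\row_j 'd_j q)).
    apply: det_1D_rank1; apply/matrixP => i j; rewrite !mxE -[RHS]Dq.
    by apply: eq_bigr => l _; rewrite !mxE mulrC mul_mpolyC.
  apply/matrixP => i j; rewrite !mxE big_ord1 !mxE mderivD mderivY mderivZ mul1r.
  by rewrite mul_mpolyC.
- by move=> i; rewrite /S mul1r [_ - 'Y_i]addrC addKr subrr; apply: supported0.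
- by move=> i; rewrite /S mulN1r scaleNr [_ - 'Y_i]addrC addKr addNr; apply: supported0.
Qed.

Definition ham (i j : 'I_3) s (l : 'I_3) : A :=
  if l == i then 'd_j s else if l == j then - 'd_i s else 0.

Lemma homog_ham d i j s l : homog d.+1 s -> homog d (ham i j s l).
Proof.
rewrite /ham => Hs; case: ifP => _; first exact: mderiv_homog.
by case: ifP => _; [apply: supportedN; apply: mderiv_homog | apply: supported0].
Qed.

Lemma mderiv_sum i (I : Type) (r : seq I) (F : I -> A) :
  'd_i (\sum_(x <- r) F x) = \sum_(x <- r) 'd_i (F x).
Proof. exact: (big_morph _ (mderivD i) (mderiv0 R i)). Qed.

Lemma ham_sum i j (I : Type) (r : seq I) (F : I -> A) l :
  ham i j (\sum_(x <- r) F x) l = \sum_(x <- r) ham i j (F x) l.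
Proof.
rewrite /ham; case: (l == i); first exact: mderiv_sum.
case: (l == j); last by rewrite big1.
by rewrite mderiv_sum sumrN.
Qed.

Lemma hamZ i j c s l : ham i j (c *: s) l = c *: ham i j s l.
Proof. by rewrite /ham !mderivZ; case: ifP => // _; case: ifP => // _; rewrite ?scalerN ?scaler0. Qed.

Lemma mderivXn i p n : 'd_i (p ^+ n) = (p ^+ n.-1 * 'd_i p) *+ n.
Proof.
elim: n => [|n IH]; first by rewrite expr0 mulr0n -[1]/(mpolyC 3 1) mderivC.
rewrite exprS mderivM IH /= mulrnAr [in RHS]mulrS [p ^+ n * _]mulrC.
by case: n {IH} => [|n]; rewrite ?mulr0n //= exprS; congr (_ + _ *+ _); rewrite !mulrA; ring.
Qed.

(** Only the planes (x, y) and (y, z) occur; [k] is the coordinate left over. *)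
Definition cyc (i j k : 'I_3) :=
  (i, j, k) = (i0, i1, i2) \/ (i, j, k) = (i1, i2, i0).

Lemma cyc_neq i j k : cyc i j k ->
  [/\ (i == j) = false, (j == i) = false, (k == i) = false & (k == j) = false].
Proof. by case=> -[-> -> ->]. Qed.

Lemma cyc_sum i j k (V : nmodType) (F : 'I_3 -> V) : cyc i j k ->
  \sum_l F l = F k + (F i + F j).
Proof. by rewrite sum_ord3; case=> -[-> -> ->]; [rewrite addrC | rewrite addrA]. Qed.

Lemma cyc_mpolyX i j k m : cyc i j k ->
  mpolyX R m = 'Y_k ^+ m k * ('Y_i ^+ m i * 'Y_j ^+ m j).
Proof.
have -> : mpolyX R m = 'Y_i0 ^+ m i0 * 'Y_i1 ^+ m i1 * 'Y_i2 ^+ m i2 :> A.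
  by rewrite mpolyXE_id big_ord3.
by case=> -[-> -> ->]; [rewrite mulrC | rewrite mulrA].
Qed.

(** The Hamiltonian depends on x_k and L = x_i + t x_j only, so its field is a polynomial in x_k and
    L times a multiple of t e_i - e_j, a direction along which x_k and L are constant: it generates
    a shear. *)
Lemma realizes_ham_power i j k d e n t : cyc i j k -> (e + n = d.+1)%N ->
  forall c, realizes d (ham i j (c *: ('Y_k ^+ e * ('Y_i + t *: 'Y_j) ^+ n))).
Proof.
move=> ijk en c; have [ij ji ki kj] := cyc_neq ijk.
set L : A := 'Y_i + t *: 'Y_j.
have Lk : 'd_k L = 0 by rewrite mderivD mderivZ !mderivY (eq_sym i) ki (eq_sym j) kj scaler0 addr0.
have Li : 'd_i L = 1 by rewrite mderivD mderivZ !mderivY eqxx ji scaler0 addr0.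
have Lj : 'd_j L = t *: 1 by rewrite mderivD mderivZ !mderivY eqxx ij add0r.
have Di f a : 'd_i ('Y_k ^+ f * L ^+ a) = ('Y_k ^+ f * L ^+ a.-1) *+ a.
  rewrite mderivM !mderivXn mderivY ki Li mulr0 mul0rn mul0r add0r mulr1.
  by rewrite mulrnAr.
have Dj f a : 'd_j ('Y_k ^+ f * L ^+ a) = t *: 'd_i ('Y_k ^+ f * L ^+ a).
  rewrite Di mderivM !mderivXn mderivY kj Lj mulr0 mul0rn mul0r add0r.
  by rewrite -scalerAr mulr1 mulrnAr -scalerAr scalerMnr.
(* For n = 0 the predecessor truncates, but [v] is then zero. *)
pose q : A := 'Y_k ^+ e * L ^+ n.-1.
pose v l : R := if l == i then c * (n%:R * t) else if l == j then - (c * n%:R) else 0.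
rewrite (_ : ham _ _ _ = fun l => v l *: q).
  apply: realizes_shear => [u|].
    rewrite /q substM !substXn substY substD substZ !substY /v ki kj eqxx ji eqxx.
    congr (_ * _ ^+ _); first by rewrite mulr0 scale0r addr0.
    rewrite /L scalerDr scalerA addrACA -[RHS]addr0; congr (_ + _).
    by rewrite -scalerDl -[RHS](scale0r q); congr (_ *: _); ring.
  rewrite (cyc_sum _ ijk) /v ki kj eqxx ji eqxx scale0r add0r /q Dj scalerA -scalerDl.
  by rewrite (_ : _ + _ = 0) ?scale0r //; ring.
apply/funext => l; rewrite hamZ /ham Dj Di -/q /v -scaler_nat.
case: ifP => _; first by rewrite !scalerA; congr (_ *: _); ring.
by case: ifP => _; rewrite ?scale0r ?scaler0 // scalerN scalerA scaleNr.
Qed.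

Lemma homogXn p a : homog 1 p -> homog a (p ^+ a).
Proof.
move=> Hp; elim: a => [|a IH]; first exact: (supportedC (c := 1)).
by rewrite exprS; apply: (homogM (k := 1)).
Qed.

(* By [power_span], the monomial Hamiltonian x_k^a x_i^b x_j^c is a combination
   of the Hamiltonians of shears x_k^a (x_i + t x_j)^(b + c). *)
Lemma realizes_ham i j k d s : cyc i j k -> (1 < d)%N -> homog d.+1 s ->
  realizes d (ham i j s).
Proof.
move=> ijk d1 Hs.
have E s1 : homog d.+1 s1 -> forall l, ord d (ham i j s1 l).
  by move=> Hs1 l; apply: homog_ord; apply: homog_ham.
have mono m : m \in msupp s -> realizes d (ham i j (s@_m *: mpolyX R m)).
  move=> /Hs /eqP; rewrite mdegE (cyc_sum _ ijk) => md.
  have [c Hc] := @power_span R (m i + m j) (m j) (leq_addl _ _).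
  rewrite (cyc_mpolyX m ijk) -{1}(addnK (m j) (m i)) -(Hc A).
  rewrite mulr_sumr scaler_sumr.
  rewrite (_ : ham i j _ = fun l => \sum_t ham i j
     (s@_m *: ('Y_k ^+ m k * (c t *: ('Y_i + t%:R *: 'Y_j) ^+ (m i + m j)))) l); last first.
    by apply/funext => l; rewrite ham_sum.
  apply: realizes_sum => // [t l|t]; rewrite -scalerAr scalerA.
    apply: E; apply: supportedZ; rewrite -md.
    apply: homogM; apply: homogXn; first exact: supportedY.
    by apply: supportedD; [|apply: supportedZ]; apply: supportedY.
  exact: realizes_ham_power.
(* [realizes_sum] constrains every index, so terms outside the support are replaced by zero. *)
rewrite (mpolyE s) (_ : ham i j _ = fun l => \sum_(m <- msupp s)
    (if m \in msupp s then ham i j (s@_m *: mpolyX R m) l else 0)); last first.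
  by apply/funext => l; rewrite ham_sum; apply: eq_big_seq => m ->.
apply: realizes_sum => // [m l|m]; last first.
  by move: (mono m); case: (m \in _) => [/(_ isT)|_] //; apply: realizes0.
case: ifP => [/Hs md|_]; last exact: supported0.
by apply: E; apply: supportedZ; apply: supportedX.
Qed.

(** A potential [s] in the (x, y) plane accounts for the first component. What remains of the field
    lies in the (y, z) plane and is divergence free there, hence has a potential [r]. *)
Lemma realizes_divfree d h : (1 < d)%N -> (forall i, homog d (h i)) -> divg h = 0 ->
  realizes d h.
Proof.
move=> d1 Hh Dh.
pose s := mint i1 (h i0); pose g := h i1 + 'd_i0 s.
have Hs : homog d.+1 s by apply: homog_mint.
have Hg : homog d g by apply: supportedD; [apply: Hh | apply: mderiv_homog].
have Eg : 'd_i1 g = - 'd_i2 (h i2).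
  rewrite /g mderivD mderiv_comm mderiv_mint; apply/eqP; rewrite -subr_eq0 opprK.
  by rewrite -Dh /divg; apply/eqP; ring.
(* [r0] has the right z-derivative. Its defect [e] in the y-derivative does not depend on z, so an
   antiderivative of [e] in y can be subtracted without changing the z-derivative. *)
pose r0 := mint i2 g; pose e := 'd_i1 r0 + h i2; pose r := r0 - mint i1 e.
have Hr0 : homog d.+1 r0 by apply: homog_mint.
have He : homog d e by apply: supportedD; [apply: mderiv_homog | apply: Hh].
have Hr : homog d.+1 r by apply: supportedB => //; apply: homog_mint.
have De : 'd_i2 e = 0 by rewrite /e mderivD mderiv_comm mderiv_mint Eg addNr.
have Er2 : 'd_i2 r = g.
  by rewrite /r mderivB mderiv_mint mderiv_mintC // De /mint msupp0 big_nil subr0.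
have Er1 : 'd_i1 r = - h i2 by rewrite /r mderivB mderiv_mint /e opprD addrA subrr add0r.
have -> : h = fun l => ham i0 i1 s l + ham i1 i2 r l.
  apply/funext => l; elim/forall_ord3: l; rewrite /ham /=.
  - by rewrite addr0 mderiv_mint.
  - by rewrite Er2 /g addrC addrK.
  - by rewrite add0r Er1 opprK.
apply: realizesD => // [l|l||]; try by apply: homog_ord; apply: homog_ham.
  by apply: realizes_ham Hs => //; left.
by apply: realizes_ham Hr => //; right.
Qed.

End Automorphisms.

(** * The polynomial normal form *)

(** Sorted by degree in [k]: trace, principal minors, determinant. Near the identity the trace
    dominates, which is how [divg_ord] reads off the divergence. *)
Lemma det_1D3 (R : comNzRingType) (k : 'I_3 -> 'I_3 -> R) :
  \det (\matrix_(i, j) ((i == j)%:R + k i j)) = 1 + (k i0 i0 + k i1 i1 + k i2 i2)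
   + (k i0 i0 * k i1 i1 - k i0 i1 * k i1 i0 + (k i0 i0 * k i2 i2 - k i0 i2 * k i2 i0)
   + (k i1 i1 * k i2 i2 - k i1 i2 * k i2 i1)
   + (k i0 i0 * (k i1 i1 * k i2 i2 - k i1 i2 * k i2 i1)
    - k i0 i1 * (k i1 i0 * k i2 i2 - k i1 i2 * k i2 i0)
    + k i0 i2 * (k i1 i0 * k i2 i1 - k i1 i1 * k i2 i0))).
Proof.
rewrite (expand_det_row _ i0) sum_ord3 /cofactor.
rewrite !(expand_det_row _ ord0) !big_ord_recl !big_ord0 /cofactor !det_mx11 !mxE.
rewrite (_ : lift i0 ord0 = i1); last exact: val_inj.
rewrite (_ : lift i1 ord0 = i0); last exact: val_inj.
rewrite (_ : lift i2 ord0 = i0); last exact: val_inj.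
rewrite (_ : lift i0 (lift ord0 ord0) = i2); last exact: val_inj.
rewrite (_ : lift i1 (lift ord0 ord0) = i2); last exact: val_inj.
rewrite (_ : lift i2 (lift ord0 ord0) = i1); last exact: val_inj.
rewrite (_ : lift i0 (lift (lift ord0 ord0) ord0) = i1); last exact: val_inj.
rewrite (_ : lift i1 (lift (lift ord0 ord0) ord0) = i0); last exact: val_inj.
rewrite (_ : lift i2 (lift (lift ord0 ord0) ord0) = i0); last exact: val_inj.
rewrite /= /bump /= !(exprS, expr0).
by ring.
Qed.

Section NormalForm.
Context {R : numFieldType}.
Local Notation A := (mpoly 3 R).
Implicit Types (p q : mpoly 2 R) (h F B P Q : 'I_3 -> A).

Lemma jac_Jvec_det B : \det (jac (Jvec B)) = \det (jac B).
Proof.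
pose M : 'M[A]_3 := \matrix_(i, j) ((i == j)%:R + (j == i.+1 :> nat)%:R).
have -> : jac (Jvec B) = M *m jac B.
  apply/matrixP => i j; rewrite !mxE sum_ord3 !mxE.
  by elim/forall_ord3: i; rewrite /Jvec triE ?mderivD /=; ring.
rewrite det_mulmx [\det M]det_1D3 /=; ring.
Qed.

Lemma JvecD h h' i : Jvec (fun j => h j + h' j) i = Jvec h i + Jvec h' i.
Proof. by elim/forall_ord3: i; rewrite /Jvec !triE; ring. Qed.

Lemma JvecB h h' i : Jvec (fun j => h j - h' j) i = Jvec h i - Jvec h' i.
Proof. by elim/forall_ord3: i; rewrite /Jvec !triE; ring. Qed.

Lemma supported_Jvec (S : pred nat) h : (forall i, supported S (h i)) -> forall i, supported S (Jvec h i).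
Proof.
by move=> Hh i; elim/forall_ord3: i; rewrite /Jvec triE; do ?apply: supportedD; apply: Hh.
Qed.

Lemma supported_Jvecinv (S : pred nat) h : (forall i, supported S (h i)) ->
  forall i, supported S (Jvecinv h i).
Proof.
move=> Hh i; elim/forall_ord3: i; rewrite /Jvecinv triE;
  by do ?[apply: supportedD|apply: supportedN]; apply: Hh.
Qed.

Lemma supported_tri (S : pred nat) (a b c : A) :
  supported S a -> supported S b -> supported S c -> forall i, supported S (tri a b c i).
Proof. by move=> ? ? ? i; elim/forall_ord3: i; rewrite triE. Qed.

Lemma Jvec_pid i : Jvec (pid : 'I_3 -> A) i = Jpol i. Proof. by []. Qed.

Lemma subst_Jvec G h i : subst G (Jvec h i) = Jvec (fun j => subst G (h j)) i.
Proof. by elim/forall_ord3: i; rewrite /Jvec !triE ?substD. Qed.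

Definition lift2 p : A := subst (fun i : 'I_2 => if val i == 0%N then 'Y_i0 else 'Y_i1) p.

Definition Gpol p : 'I_3 -> A := Jvec (fun i => 'Y_i + tri 0 0 (lift2 p) i).

Lemma ord_lift2 d p : ord d p -> ord d (lift2 p).
Proof. by apply: ord_subst => i; case: ifP => _; apply: supportedY. Qed.

Lemma mderiv2_lift2 p : 'd_i2 (lift2 p) = 0.
Proof.
by rewrite mderiv_subst big1 // => i _; case: ifP => _; rewrite mderivY mulr0.
Qed.

(** In characteristic zero a vanishing z-derivative means that no monomial contains z. *)
Lemma mderiv0_subst_plane (q : A) : 'd_i2 q = 0 -> subst (tri 'Y_i0 'Y_i1 0) q = q.
Proof.
move=> Dq; rewrite {2}(mpolyE q) {1}(mpolyE q) subst_sum; apply: eq_big_seq => m mq.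
rewrite substZ; congr (_ *: _); have m2 : m i2 = 0%N.
  apply/eqP; rewrite -leqn0 leqNgt; apply: contraTN mq => m2.
  have := congr1 (mcoeff (mnm_sub m (mnm1 i2))) Dq.
  rewrite mcoeff_mderiv mcoeff0 -(mnm_sub1K m2) => /eqP.
  by rewrite mulrn_eq0 /= mcoeff_eq0.
have ijk : cyc i0 i1 i2 by left.
rewrite (cyc_mpolyX m ijk) m2 expr0 mul1r substM !substXn !substY !triE //.
Qed.

Lemma lift2_onto d (q : A) : homog d q -> 'd_i2 q = 0 ->
  exists2 p : mpoly 2 R, homog d p & lift2 p = q.
Proof.
move=> Hq Dq; exists (subst (tri 'Y_ord0 'Y_ord_max 0) q).
  apply: homog_subst => // i; elim/forall_ord3: i; rewrite triE;
    [exact: supportedY | exact: supportedY | exact: supported0].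
rewrite /lift2 subst_subst -[RHS](mderiv0_subst_plane Dq); apply: eq_subst => i.
by elim/forall_ord3: i; rewrite !triE ?substY ?subst0.
Qed.

Lemma lift2D p q : lift2 (p + q) = lift2 p + lift2 q. Proof. exact: substD. Qed.

Lemma GpolD p q i : Gpol (p + q) i = Gpol p i + Jvec (tri 0 0 (lift2 q)) i.
Proof.
transitivity (Jvec (fun j => ('Y_j + tri 0 0 (lift2 p) j) + tri 0 0 (lift2 q) j) i); last exact: JvecD.
rewrite /Gpol lift2D; congr (Jvec _ i); apply/funext => j.
by elim/forall_ord3: j; rewrite !triE ?addr0 ?addrA.
Qed.

Lemma det_jac_Gpol p : \det (jac (Gpol p)) = 1.
Proof.
rewrite jac_Jvec_det; pose k (i j : 'I_3) := 'd_j (tri 0 0 (lift2 p) i).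
rewrite (_ : jac _ = \matrix_(i, j) ((i == j)%:R + k i j)); last first.
  by apply/matrixP => i j; rewrite !mxE mderivD mderivY.
by rewrite det_1D3 /k !triE !mderiv0 mderiv2_lift2; ring.
Qed.

(** Write F = J (id + p e3 + c). The trace of the derivative of p e3 + c is div c, since p does not
    involve z. Each product in the minors has a factor from one of the first two rows, of order d -
    1, and another of order at least 1, so these terms have order d. *)
Lemma divg_ord d p F : (1 < d)%N -> ord 2 p -> (forall i, ord d (F i - Gpol p i)) ->
  ord d (\det (jac F) - 1) ->
  ord d (divg (Jvecinv (fun i => F i - Gpol p i))).
Proof.
case: d => // d d1 Hp HF; pose c := Jvecinv (fun i => F i - Gpol p i).
have Hc : forall i, ord d.+1 (c i) by apply: supported_Jvecinv.
have EF : F = Jvec (fun i => 'Y_i + (tri 0 0 (lift2 p) i + c i)).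
  apply/funext => i; rewrite -[F i](subrK (Gpol p i)) -(JvecinvK (fun i => F i - Gpol p i)).
  by rewrite -/c /Gpol -JvecD; congr Jvec; apply/funext => j; ring.
rewrite -/c; clearbody c; pose k (i j : 'I_3) := 'd_j (tri 0 0 (lift2 p) i + c i).
rewrite {1}EF jac_Jvec_det (_ : jac _ = \matrix_(i, j) ((i == j)%:R + k i j)); last first.
  by apply/matrixP => i j; rewrite !mxE mderivD mderivY.
have Hk01 i j : i != i2 -> ord d (k i j).
  by elim/forall_ord3: i => // _; rewrite /k triE add0r; apply: mderiv_ord.
(* The last row contains the derivatives of p, hence order 1 is all that holds there. *)
have Hk2 j : ord 1 (k i2 j).
  rewrite /k triE mderivD; apply: supportedD; apply: mderiv_ord; first exact: ord_lift2.
  exact: ordW (Hc _).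
have Hk1 i j : ord 1 (k i j).
  by elim/forall_ord3: i; [apply: ordW (Hk01 i0 j isT) | apply: ordW (Hk01 i1 j isT) |].
have two i j i' j' : i != i2 -> ord d.+1 (k i j * k i' j').
  by move=> ni; rewrite -(addn1 d); apply: ordM (Hk01 _ _ ni) (Hk1 _ _).
have three i j (s : A) : i != i2 -> ord d.+1 s -> ord d.+1 (k i j * s).
  by move=> ni Hs; apply: (@ordW _ _ _ (d + d.+1)); [lia | apply: ordM (Hk01 _ _ ni) Hs].
rewrite det_1D3 (_ : divg _ = k i0 i0 + k i1 i1 + k i2 i2); last first.
  by rewrite /divg /k !triE !add0r (mderivD i2) mderiv2_lift2 add0r.
set t := _ + _ + k i2 i2; set r := (X in 1 + t + X).
rewrite (_ : 1 + t + r - 1 = t + r); last by ring.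
have minor i j i' j' l m l' m' : i != i2 -> l != i2 ->
    ord d.+1 (k i j * k i' j' - k l m * k l' m').
  by move=> ni nl; apply: supportedB; apply: two.
have Hr : ord d.+1 r.
  apply: supportedD.
    by apply: supportedD; [apply: supportedD; apply: minor | apply: minor].
  apply: supportedD; first apply: supportedB; by apply: three => //; apply: minor.
by move=> Htr; rewrite -[t](addrK r); apply: supportedB.
Qed.

(** The divergence of the leading part is homogeneous of degree d, yet it is a difference of two
    terms of order d + 1. *)
Lemma divg_homog0 d h : (forall i, ord d.+1 (h i)) -> ord d.+1 (divg h) ->
  divg (fun i => pihomog mdeg d.+1 (h i)) = 0.
Proof.
move=> Hh Dh; set b := fun i => _.
have Db : homog d (divg b).
  by do ?apply: supportedD; apply: mderiv_homog; apply: homog_pihomog.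
apply: (supported_eq0 Db (Q := leq d.+1)) => [|e /eqP->]; last by rewrite ltnn.
rewrite (_ : divg b = divg h - divg (fun i => h i - b i)); last first.
  by rewrite /divg !mderivB; ring.
by apply: supportedB => //; do ?apply: supportedD; apply: mderiv_ord; apply: ord_pihomog.
Qed.

Lemma normal_form_step d p F : (1 < d)%N -> ord 2 p ->
  (forall i, ord d (F i - Gpol p i)) -> ord d (\det (jac F) - 1) ->
  exists P Q q, [/\ vol_aut P Q, forall i, ord d (P i - 'Y_i),
    forall i, ord d (Q i - 'Y_i), ord 2 q &
    forall i, ord d.+1 (pcomp P (pcomp F Q) i - Gpol q i)].
Proof.
case: d => // d d1 Hp HF DF.
pose E i := F i - Gpol p i; pose c := Jvecinv E; pose b i := pihomog mdeg d.+1 (c i).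
have Hc : forall i, ord d.+1 (c i) by apply: supported_Jvecinv.
have Hb i : homog d.+1 (b i) by apply: homog_pihomog.
have Db : divg b = 0 by apply: divg_homog0 => //; apply: divg_ord.
have [h [q [Hh Dh Hq Dq hq]]] := homological (Hb i0) (Hb i1) (Hb i2) Db.
have [P [Q [PQ HP HQ]]] := realizes_divfree d1 Hh Dh.
have [p' Hp' Ep'] := lift2_onto Hq Dq.
have oh i : ord d.+1 (h i) by apply: homog_ord.
have HQY j : ord d.+1 (Q j - pid j).
  rewrite -(addrK (h j) (Q j - pid j)).
  by apply: supportedB; [apply: ordW (HQ j) | apply: oh].
exists P, Q, (p + p'); split; [exact: PQ | | | |].
- move=> i; rewrite -(subrK (h i) (P i - 'Y_i)).
  by apply: supportedD; [apply: ordW (HP i) | apply: oh].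
- by move=> i; apply: ordW (HQY i).
- by apply: supportedD; [apply: Hp | apply: ordW (homog_ord Hp')].
move=> i.
have oQ j : ord 1 (Q j).
  by rewrite -(subrK (pid j) (Q j)); apply: supportedD; [apply: ordW (HQY j) | apply: ord1Y].
(* The nonlinear part is split off: the linear part J is composed with Q exactly, and only [F2]
   produces an error. *)
pose F2 j := F j - Jpol j.
have oF2 j : ord 2 (F2 j).
  rewrite (_ : F2 j = E j + Jvec (tri 0 0 (lift2 p)) j); last first.
    by rewrite /E /Gpol JvecD Jvec_pid /F2; ring.
  apply: supportedD; first exact: ordW (HF j).
  by apply: supported_Jvec; apply: supported_tri; [apply: supported0 .. | apply: ord_lift2].
have oJ j : ord 1 (Jpol j) by apply: homog_ord; apply: homog_Jpol.
pose FQ := pcomp F Q.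
have EFQ j : FQ j = Jpol j + F2 j - Jvec h j + (subst Q (F2 j) - subst pid (F2 j))
    + Jvec (fun l => Q l - 'Y_l + h l) j.
  rewrite subst_id JvecD JvecB -[Jvec (fun l => 'Y_l) j]/(Jpol j).
  rewrite /FQ /pcomp -{1}(subrK (Jpol j) (F j)) -/(F2 j) substD -{1}Jvec_pid subst_Jvec.
  rewrite (_ : Jvec (fun l => subst Q (pid l)) j = Jvec Q j); first by ring.
  by congr Jvec; apply/funext => l; rewrite substY.
(* [F2] has order 2 and Q - id has order d + 1, so exchanging Q for id changes [F2] at order d +
   2. *)
have oR1 j : ord d.+2 (subst Q (F2 j) - subst pid (F2 j)).
  by apply: (@ord_substB _ _ _ 1 d.+1) => // l; apply: ord1Y.
have oR2 : forall j, ord d.+2 (Jvec (fun l => Q l - 'Y_l + h l) j).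
  exact: supported_Jvec.
have oFQ2 j : ord 2 (FQ j - Jpol j).
  rewrite EFQ (_ : _ - Jpol j = F2 j - Jvec h j + (subst Q (F2 j) - subst pid (F2 j))
    + Jvec (fun l => Q l - 'Y_l + h l) j); last first.
    by move: (Jpol j) (F2 j) (Jvec h j) (_ - _) (Jvec (fun l => _) j) => *; ring.
  apply: supportedD; last by apply: ordW (oR2 j).
  apply: supportedD; last by apply: ordW (oR1 j).
  apply: supportedB; first exact: oF2.
  by apply: supported_Jvec => l; apply: ordW (oh l).
have oFQ j : ord 1 (FQ j).
  by rewrite -(subrK (Jpol j) (FQ j)); apply: supportedD; [apply: ordW (oFQ2 j) | apply: oJ].
have oR3 : ord d.+2 (subst FQ (P i - 'Y_i - h i)) by apply: ord_subst.
(* Likewise h has order d + 1 and F o Q - J has order 2, so h may be evaluated at J instead. *)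
have oR4 : ord d.+2 (subst FQ (h i) - subst Jpol (h i)).
  by rewrite -(addn2 d); apply: ord_substB.
have oR5 : ord d.+2 (Jvec (fun j => c j - b j) i).
  by apply: supported_Jvec => j; apply: ord_pihomog.
have EE : E i = Jvec b i + Jvec (fun j => c j - b j) i.
  by rewrite JvecB [RHS]addrC subrK /c JvecinvK.
(* The homological equation multiplied by J: of the error in degree d + 1 only J e3 q survives. *)
have EJ : Jvec h i - subst Jpol (h i) = Jvec b i - Jvec (tri 0 0 q) i.
  have := congr1 (fun g => Jvec g i) (funext hq).
  by rewrite !JvecB JvecinvK.
rewrite GpolD Ep' (_ : _ - _ = Jvec (fun j => c j - b j) i
  + (subst FQ (h i) - subst Jpol (h i)) + subst FQ (P i - 'Y_i - h i)
  + (subst Q (F2 i) - subst pid (F2 i)) + Jvec (fun l => Q l - 'Y_l + h l) i).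
  exact: (supportedD (supportedD (supportedD (supportedD oR5 oR4) oR3) (oR1 i)) (oR2 i)).
have -> : pcomp P FQ i = FQ i + subst FQ (h i) + subst FQ (P i - 'Y_i - h i).
  rewrite !substB substY /pcomp.
  by move: (FQ i) (subst FQ (h i)) (subst FQ (P i)) => *; ring.
have EF2 : Jpol i + F2 i = E i + Gpol p i by rewrite /F2 /E; ring.
have EJ' : Jvec h i = Jvec b i - Jvec (tri 0 0 q) i + subst Jpol (h i) by rewrite -EJ subrK.
rewrite EFQ EF2 EE EJ'.
move: (Jvec b i) (Jvec (fun j => c j - b j) i) (Jvec (tri 0 0 q) i) (Gpol p i) (subst Jpol (h i))
  (subst Q (F2 i)) (subst pid (F2 i)) (Jvec (fun l => Q l - 'Y_l + h l) i)
  (subst FQ (h i)) (subst FQ (P i - 'Y_i - h i)) => *.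
by ring.
Qed.

(** The target degree is D + 2. The step from order k + 2 to k + 3 uses that det DF - 1 has order k
    + 2, where k is at most D. *)
Lemma normal_form_poly D F : (forall i, ord 2 (F i - Jpol i)) ->
  ord D.+2 (\det (jac F) - 1) ->
  exists P Q q, [/\ vol_aut P Q, forall i, ord 2 (P i - 'Y_i),
    forall i, ord 2 (Q i - 'Y_i), ord 2 q &
    forall i, ord D.+3 (pcomp P (pcomp F Q) i - Gpol q i)].
Proof.
move=> HF DF.
have oJ j : ord 1 (Jpol j) by apply: homog_ord; apply: homog_Jpol.
suff H k : (k <= D.+1)%N -> exists P Q q, [/\ vol_aut P Q, forall i, ord 2 (P i - 'Y_i),
    forall i, ord 2 (Q i - 'Y_i), ord 2 q &
    forall i, ord k.+2 (pcomp P (pcomp F Q) i - Gpol q i)] by apply: H.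
elim: k => [|k IH] kD.
  exists pid, pid, 0; split; [exact: vol_aut_id | | | exact: supported0 | ].
    by move=> i; rewrite subrr; apply: supported0.
    by move=> i; rewrite subrr; apply: supported0.
  move=> i; rewrite pcomp_idl pcomp_id (_ : Gpol 0 i = Jpol i) //.
  rewrite /Gpol -Jvec_pid; congr Jvec; apply/funext => j; rewrite /lift2 subst0.
  by elim/forall_ord3: j; rewrite triE addr0.
have [P [Q [q [PQ HP HQ Hq HF']]]] := IH (ltnW kD).
have dQ := vol_aut_det_inv PQ; have [_ _ dP] := PQ.
have ord1_near (G : 'I_3 -> A) : (forall i, ord 2 (G i - 'Y_i)) -> forall i, ord 1 (G i).
  move=> HG i; rewrite -(subrK 'Y_i (G i)).
  by apply: supportedD; [apply: ordW (HG i) | apply: ord1Y].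
have near_comp (G G' : 'I_3 -> A) : (forall i, ord 2 (G i - 'Y_i)) ->
    (forall i, ord 2 (G' i - 'Y_i)) -> forall i, ord 2 (pcomp G G' i - 'Y_i).
  move=> HG HG' i; rewrite (_ : _ - _ = subst G' (G i - 'Y_i) + (G' i - 'Y_i)).
    apply: supportedD; last exact: HG'.
    by apply: ord_subst; [apply: ord1_near | apply: HG].
  by rewrite substB substY /pcomp; ring.
have [|P' [Q' [q' [PQ' HP' HQ' Hq' HF'']]]] := normal_form_step (isT : 1 < k.+2)%N Hq HF'.
  (* P and Q have Jacobian one, so the Jacobian of the conjugate is that of F composed with Q, and
     its distance to 1 keeps its order. *)
  rewrite !det_jac_comp dP subst1 mul1r dQ mulr1.
  rewrite -(subst1 Q) -substB; apply: ord_subst; first exact: ord1_near.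
  exact: ordW DF.
exists (pcomp P' P), (pcomp Q Q'), q'; split.
- exact: vol_aut_comp.
- by apply: near_comp => [i|]; [apply: ordW (HP' i) | apply: HP].
- by apply: near_comp => [|i]; [apply: HQ | apply: ordW (HQ' i)].
- exact: Hq'.
- by rewrite -pcompA (pcompA F) (pcompA P).
Qed.

End NormalForm.

(** * Polynomial functions and orders of vanishing *)

Section Analysis.
Context {R : realType}.
Local Notation V := 'cV[R]_3.
Local Notation A := (mpoly 3 R).
Implicit Types (p q G : A) (u v w : V -> R) (x y : V).

Lemma nearP (P : V -> Prop) : (\forall x \near (0 : V), P x) <->
  exists2 e : R, 0 < e & forall x, `|x| < e -> P x.
Proof.
split=> [/nbhs_norm0P[e /= e0 H]|[e e0 H]]; first by exists e => // x /H.
by apply/nbhs_norm0P; exists e.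
Qed.

Lemma coord_le_norm x i : `|x i 0| <= `|x|.
Proof. by rewrite [leRHS]/Num.Def.normr/= mx_normrE; apply: (le_bigmax _ _ (i, 0)). Qed.

Lemma norm_le_coord x (c : R) : 0 <= c -> (forall i, `|x i 0| <= c) -> `|x| <= c.
Proof.
move=> c0 H; rewrite [leLHS]/Num.Def.normr/= mx_normrE; apply: bigmax_le => // -[i j] _ /=.
by rewrite ord1.
Qed.

Definition bigO k u := exists C, \forall x \near (0 : V), `|u x| <= C * `|x| ^+ k.

Lemma bigO_pos k u : bigO k u ->
  exists2 C, 0 <= C & \forall x \near (0 : V), `|u x| <= C * `|x| ^+ k.
Proof.
move=> [C H]; exists (Num.max C 0); first by rewrite le_max lexx orbT.
near=> x; apply: (@le_trans _ _ (C * `|x| ^+ k)); first by near: x.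
by apply: ler_wpM2r; rewrite ?exprn_ge0 // le_max lexx.
Unshelve. all: by end_near. Qed.

Lemma bigO_near k u v : (\forall x \near (0 : V), u x = v x) -> bigO k u -> bigO k v.
Proof.
move=> uv [C H]; exists C; near=> x.
have <- : u x = v x by near: x.
by near: x.
Unshelve. all: by end_near. Qed.

Lemma bigO_eq k u v : u =1 v -> bigO k u -> bigO k v.
Proof. by move=> uv; apply: bigO_near; near=> x; apply: uv. Unshelve. all: by end_near. Qed.

Lemma bigO0 k : bigO k (fun=> 0).
Proof. by exists 0; near=> x; rewrite normr0 mul0r. Unshelve. all: by end_near. Qed.

Lemma bigO_cst (c : R) : bigO 0 (fun=> c).
Proof. by exists `|c|; near=> x; rewrite expr0 mulr1. Unshelve. all: by end_near. Qed.

Lemma bigO_coord i : bigO 1 (fun x => x i 0).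
Proof.
by exists 1; near=> x; rewrite expr1 mul1r coord_le_norm.
Unshelve. all: by end_near. Qed.

Lemma bigOD k u v : bigO k u -> bigO k v -> bigO k (fun x => u x + v x).
Proof.
move=> [C H] [C' H']; exists (C + C'); near=> x; rewrite mulrDl.
by apply: le_trans (ler_normD _ _) _; apply: lerD; near: x.
Unshelve. all: by end_near. Qed.

Lemma bigON k u : bigO k u -> bigO k (fun x => - u x).
Proof.
by move=> [C H]; exists C; near=> x; rewrite normrN; near: x.
Unshelve. all: by end_near. Qed.

Lemma bigOB k u v : bigO k u -> bigO k v -> bigO k (fun x => u x - v x).
Proof. by move=> Hu Hv; apply: bigOD => //; apply: bigON. Qed.

Lemma bigOM k l u v : bigO k u -> bigO l v -> bigO (k + l) (fun x => u x * v x).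
Proof.
move=> [C H] [C' H']; exists (C * C'); near=> x.
rewrite normrM exprD mulrACA; apply: ler_pM => //; by near: x.
Unshelve. all: by end_near. Qed.

Lemma bigOW k l u : (k <= l)%N -> bigO l u -> bigO k u.
Proof.
move=> kl /bigO_pos[C C0 H]; exists C; near=> x.
apply: (@le_trans _ _ (C * `|x| ^+ l)); first by near: x.
apply: ler_wpM2l => //; apply: ler_wiXn2l => //.
Unshelve. all: by end_near. Qed.

Lemma bigO_comp k u (F : V -> V) : (forall i, bigO 1 (fun x => F x i 0)) ->
  bigO k u -> bigO k (fun x => u (F x)).
Proof.
move=> HF /bigO_pos[C C0 /nearP[e e0 Hu]].
have [c c0 Hc] : exists2 c, 0 <= c & \forall x \near (0 : V), `|F x| <= c * `|x|.
  have [c0 c00 H0] := bigO_pos (HF i0); have [c1 c10 H1] := bigO_pos (HF i1).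
  have [c2 c20 H2] := bigO_pos (HF i2).
  exists (c0 + c1 + c2); first by rewrite !addr_ge0.
  near=> x; apply: norm_le_coord => [|i]; first by rewrite mulr_ge0 // !addr_ge0.
  have G0 : `|F x i0 0| <= c0 * `|x| by near: x.
  have G1 : `|F x i1 0| <= c1 * `|x| by near: x.
  have G2 : `|F x i2 0| <= c2 * `|x| by near: x.
  have N0 := mulr_ge0 c00 (normr_ge0 x); have N1 := mulr_ge0 c10 (normr_ge0 x).
  have N2 := mulr_ge0 c20 (normr_ge0 x).
  rewrite !mulrDl; elim/forall_ord3: i; lra.
exists (C * c ^+ k); near=> x.
have Fx : `|F x| <= c * `|x| by near: x.
apply: le_trans (Hu _ _) _.
  apply: le_lt_trans Fx _; apply: (@le_lt_trans _ _ ((c + 1) * `|x|)).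
    by apply: ler_wpM2r => //; rewrite lerDl.
  rewrite -ltr_pdivlMl ?ltr_wpDl // mulrC.
  near: x; apply/nearP; exists (e / (c + 1)) => //.
  by rewrite divr_gt0 // ltr_wpDl.
by rewrite -mulrA -exprMn; apply: ler_wpM2l => //; apply: lerXn2r; rewrite ?nnegrE // mulr_ge0.
Unshelve. all: by end_near. Qed.

Lemma bigO_sum k (I : Type) (r : seq I) (F : I -> V -> R) : (forall i, bigO k (F i)) ->
  bigO k (fun x => \sum_(i <- r) F i x).
Proof.
move=> HF; elim: r => [|i r IH].
  by apply: bigO_eq (bigO0 k) => x; rewrite big_nil.
by apply: bigO_eq (bigOD (HF i) IH) => x; rewrite big_cons.
Qed.

Definition ev p x : R := meval (fun j => x j 0) p.

Lemma evD p q x : ev (p + q) x = ev p x + ev q x. Proof. exact: mevalD. Qed.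
Lemma evB p q x : ev (p - q) x = ev p x - ev q x. Proof. exact: mevalB. Qed.
Lemma evM p q x : ev (p * q) x = ev p x * ev q x. Proof. exact: mevalM. Qed.
Lemma evC c x : ev (mpolyC 3 c) x = c. Proof. exact: mevalC. Qed.
Lemma evY i x : ev 'Y_i x = x i 0. Proof. exact: mevalXU. Qed.
Lemma ev0 x : ev 0 x = 0. Proof. exact: meval0. Qed.
Lemma ev1 x : ev 1 x = 1. Proof. exact: meval1. Qed.

Definition vev (F : 'I_3 -> A) x : V := \col_i ev (F i) x.

Lemma ev_subst (F : 'I_3 -> A) p x : ev (subst F p) x = ev p (vev F x).
Proof. by rewrite /ev subst_meval; apply: meval_eq => i; rewrite mxE. Qed.

Lemma bigO_ev k p : ord k p -> bigO k (ev p).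
Proof.
move=> Hp; have HX i n : bigO n (fun x => ev ('Y_i ^+ n) x).
  elim: n => [|n IH]; first by apply: bigO_eq (bigO_cst 1) => x; rewrite expr0 ev1.
  by apply: bigO_eq (bigOM (bigO_coord i) IH) => x; rewrite exprS evM evY.
have E : ev p =1 fun x => \sum_(m <- msupp p) (if m \in msupp p then p@_m * ev (mpolyX R m) x else 0).
  move=> x; rewrite {1}(mpolyE p) /ev raddf_sum; apply: eq_big_seq => m ->.
  exact: mevalZ.
apply: bigO_eq (fsym E) _; apply: bigO_sum => m.
have [/Hp km|_] := boolP (m \in msupp p); last exact: bigO0.
apply: bigOW km _; have ijk : cyc i0 i1 i2 by left.
rewrite mdegE (cyc_sum m ijk) -[X in bigO X]add0n; apply: bigOM (bigO_cst _) _.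
rewrite (cyc_mpolyX m ijk).
apply: bigO_eq (bigOM (HX _ _) (bigOM (HX _ _) (HX _ _))) => x.
by rewrite !evM.
Qed.

Lemma is_derive_coord x (z : V) i : is_derive x z (fun y : V => y i 0 : R) (z i 0).
Proof.
have D : derivable (@id V) x z by exact: derivable_id.
apply: DeriveDef; first exact: ((derivable_mxP (@id V) x z).1 D i 0).
by have := derive_mx D; rewrite derive_id => /(congr1 (fun M : V => M i 0)); rewrite mxE.
Qed.

Lemma is_derive_ev j p x : is_derive x (ebase R j) (ev p) (ev ('d_j p) x).
Proof.
elim/(@mpoly_ring_ind 3 R): p => [c|i|p q IHp IHq|p q IHp IHq].
- rewrite mderivC ev0 (_ : ev _ = cst c); first exact: is_derive_cst.
  by apply/funext => y; rewrite evC.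
- rewrite mderivY (_ : ev 'Y_i = fun y : V => y i 0); last by apply/funext => y; rewrite evY.
  rewrite (_ : ev _ x = ebase R j i 0); first exact: is_derive_coord.
  by rewrite mxE eqxx andbT /ev rmorph_nat.
- rewrite mderivD evD (_ : ev (p + q) = ev p + ev q); first exact: is_deriveD.
  by apply/funext => y; rewrite evD.
- rewrite (_ : ev (p * q) = ev p * ev q); last by apply/funext => y; rewrite evM.
  apply: is_derive_eq; rewrite mderivM evD !evM /GRing.scale /=; ring.
Qed.

Lemma continuous_ev p : continuous (ev p).
Proof.
elim/(@mpoly_ring_ind 3 R): p => [c|i|p q IHp IHq|p q IHp IHq] x.
- by rewrite (_ : ev _ = cst c); [exact: cst_continuous | apply/funext => y; rewrite evC].
- rewrite (_ : ev 'Y_i = fun y : V => y i 0); last by apply/funext => y; rewrite evY.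
  exact: coord_continuous.
- rewrite (_ : ev (p + q) = ev p + ev q); last by apply/funext => y; rewrite evD.
  by apply: continuousD; [apply: IHp | apply: IHq].
- rewrite (_ : ev (p * q) = ev p * ev q); last by apply/funext => y; rewrite evM.
  by apply: continuousM; [apply: IHp | apply: IHq].
Qed.

(** The partial derivatives vanish as functions too, hence as polynomials by induction on the
    degree; in characteristic zero this kills every monomial of positive degree. *)
Lemma homog_ev_eq0 d p : homog d p -> (forall x, ev p x = 0) -> p = 0.
Proof.
elim: d p => [|d IH] p Hp H0.
  have Ep : p = mpolyC 3 (p@_(mnm0 : multinom 3)).
    apply/mpolyP => m; rewrite mcoeffC; case: eqP => [->|m0]; rewrite ?mulr1 // mulr0.
    by apply: (supported_coeff Hp); rewrite /= mdeg_eq0; apply/eqP.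
  by have := H0 0; rewrite Ep evC => ->; rewrite mpolyC0.
have Dp j : 'd_j p = 0.
  apply: IH; first exact: mderiv_homog.
  move=> x; have [_ <-] := is_derive_ev j p x.
  by rewrite (_ : ev p = cst 0) ?derive_cst //; apply/funext => y; rewrite H0.
apply/mpolyP => m; rewrite mcoeff0; apply/eqP; rewrite mcoeff_eq0; apply/negP => mp.
have /eqP md := Hp _ mp; have [i Em _] := mnm_predP md.
have := congr1 (mcoeff (mnm_sub m (mnm1 i))) (Dp i); rewrite mcoeff_mderiv mcoeff0 -Em => /eqP.
by rewrite mulrn_eq0 /= mcoeff_eq0 mp.
Qed.

Lemma homog_evZ d p (t : R) x : homog d p -> ev p (t *: x) = t ^+ d * ev p x.
Proof.
move=> Hp; rewrite /ev !mevalE mulr_sumr; apply: eq_big_seq => m /Hp /eqP <-.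
rewrite mulrCA; congr (_ * _); rewrite mdegE -prodrXr -big_split /=.
by apply: eq_bigr => i _; rewrite mxE exprMn.
Qed.

(** The converse of [bigO_ev]. On the ray t x the lowest homogeneous part q satisfies t^k |q(x)| <=
    C t^(k+1) |x|^(k+1); dividing by t^k and taking t small gives q = 0. *)
Lemma bigO_ord k p : bigO k (ev p) -> ord k p.
Proof.
elim: k p => [|k IH] p Hp; first by [].
have {}IH := IH _ (bigOW (leqnSn k) Hp).
have Hq := ord_pihomog IH; set q := pihomog mdeg k p in Hq.
suff q0 : q = 0 by rewrite q0 subr0 in Hq.
have hq : homog k q by apply: homog_pihomog.
have [C C0 /nearP[e e0 H]] : exists2 C, 0 <= C &
    \forall x \near (0 : V), `|ev q x| <= C * `|x| ^+ k.+1.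
  apply/bigO_pos/(bigO_eq (u := fun x => ev p x - ev (p - q) x)) => [x|].
    by rewrite evB; ring.
  by apply: bigOB => //; apply: bigO_ev.
apply: (homog_ev_eq0 hq) => x; apply/eqP; rewrite -normr_le0.
apply/ler_addgt0Pr => z z0; rewrite add0r.
pose D := C * `|x| ^+ k.+1.
(* The first bound keeps t x in the ball where the estimate holds, the second makes t D at most
   z. *)
pose t := Num.min (e / (2 * (`|x| + 1))) (z / (D + 1)).
have D0 : 0 <= D by rewrite mulr_ge0 ?exprn_ge0.
have x1 : 0 < `|x| + 1 by rewrite ltr_wpDl.
have t0 : 0 < t by rewrite lt_min !divr_gt0 ?mulr_gt0 // ltr_wpDl.
have tx : `|t *: x| < e.
  rewrite normrZ gtr0_norm //.
  apply: (@le_lt_trans _ _ (e / (2 * (`|x| + 1)) * (`|x| + 1))).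
    by apply: ler_pM; rewrite ?(ltW t0) ?normr_ge0 // ?lerDl // ge_min lexx.
  by rewrite invfM mulrA divfK ?gt_eqF // ltr_pdivrMr // ltr_pMr // ltrDl.
have := H _ tx; rewrite (homog_evZ _ _ hq) normrM normrX normrZ !(gtr0_norm t0).
have -> : C * (t * `|x|) ^+ k.+1 = t ^+ k * (t * D).
  by rewrite /D exprMn [t ^+ k.+1]exprS; ring.
rewrite ler_pM2l ?exprn_gt0 // => /le_trans; apply.
apply: (@le_trans _ _ (z / (D + 1) * (D + 1))); last by rewrite divfK // gt_eqF // ltr_wpDl.
by apply: ler_pM; rewrite ?(ltW t0) // ?lerDl // ge_min lexx orbT.
Qed.

End Analysis.

(** * Taylor expansion *)

Section Taylor.
Context {R : realType}.
Local Notation V := 'cV[R]_3.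
Local Notation A := (mpoly 3 R).
Implicit Types (p q G : A) (u v w : V -> R) (x y : V) (i j : 'I_3).

Definition cut j x : V := x - x j 0 *: ebase R j.

Lemma cutE j x i : cut j x i 0 = if i == j then 0 else x i 0.
Proof.
by rewrite !mxE andbT; case: eqP => [->|]; rewrite ?mulr1 ?subrr // mulr0 subr0.
Qed.

Lemma cut_norm j x : `|cut j x| <= `|x|.
Proof.
apply: norm_le_coord => // i; rewrite cutE; case: ifP => _; first by rewrite normr0.
exact: coord_le_norm.
Qed.

Lemma cut_idem j x : cut j (cut j x) = cut j x.
Proof. by rewrite {1}/cut cutE eqxx scale0r subr0. Qed.

Lemma cut_near (P : V -> Prop) j :
  (\forall x \near (0 : V), P x) -> \forall x \near (0 : V), P (cut j x).
Proof.
move=> /nearP[e e0 H]; apply/nearP; exists e => // x xe.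
by apply: H; apply: le_lt_trans xe; apply: cut_norm.
Qed.

Lemma bigO_cut k j u : bigO k u -> bigO k (fun x => u (cut j x)).
Proof.
apply: bigO_comp => i; exists 1; near=> x; rewrite expr1 mul1r.
exact: le_trans (coord_le_norm _ _) (cut_norm _ _).
Unshelve. all: by end_near. Qed.

Lemma line_derive w y j (t : R) (d : R) : is_derive (y + t *: ebase R j) (ebase R j) w d ->
  is_derive t 1 (fun s : R => w (y + s *: ebase R j)) d.
Proof.
have E : (fun h : R => h^-1 *: (((fun s : R => w (y + s *: ebase R j)) \o shift t) (h *: 1) -
    w (y + t *: ebase R j))) =
  (fun h : R => h^-1 *: ((w \o shift (y + t *: ebase R j)) (h *: ebase R j) - w (y + t *: ebase R j))).
  apply/funext => h; congr (_ *: (w _ - _)).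
  rewrite /= (_ : h *: (1 : R) = h); last exact: mulr1.
  by rewrite scalerDl addrCA.
by move=> [D <-]; apply: DeriveDef; rewrite ?/derivable ?/derive E.
Qed.

(** Mean value theorem on the segment from [cut j x] to [x], of length |x_j|. *)
Lemma bigO_integrate k j w :
  (\forall x \near (0 : V), derivable w x (ebase R j)) ->
  bigO k ('D_(ebase R j) w) -> bigO k.+1 (fun x => w (cut j x)) -> bigO k.+1 w.
Proof.
move=> Dw /bigO_pos[C C0 HC] Hcut.
suff H : bigO k.+1 (fun x => w x - w (cut j x)).
  by apply: bigO_eq (bigOD H Hcut) => x; rewrite subrK.
have /nearP[e e0 He] : \forall x \near (0 : V), derivable w x (ebase R j) /\
    `|'D_(ebase R j) w x| <= C * `|x| ^+ k by near do split.
exists C; apply/nearP; exists e => // x xe.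
pose phi (s : R) := w (cut j x + s *: ebase R j).
(* In the max norm, restoring part of one coordinate cannot leave the ball of radius |x|. *)
have seg (s : R) : `|s| <= `|x j 0| -> `|cut j x + s *: ebase R j| <= `|x|.
  move=> sx; apply: norm_le_coord => // i; rewrite mxE cutE !mxE andbT.
  case: eqP => [_|_]; last by rewrite mulr0 addr0; apply: coord_le_norm.
  by rewrite add0r mulr1; apply: le_trans sx (coord_le_norm _ _).
have Dphi (s : R) : `|s| <= `|x j 0| ->
    is_derive s 1 phi ('D_(ebase R j) w (cut j x + s *: ebase R j)).
  move=> sx; apply: line_derive; apply: DeriveDef => //.
  by apply: (He _ _).1; apply: le_lt_trans (seg _ sx) xe.
have mvt (a b : R) : a <= b -> (forall s, a <= s <= b -> `|s| <= `|x j 0|) ->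
    `|phi b - phi a| <= C * `|x| ^+ k * (b - a).
  move=> ab Hs; have [||c cab ->] := @MVT_segment R phi
      (fun s => 'D_(ebase R j) w (cut j x + s *: ebase R j)) a b ab.
  - by move=> s; rewrite in_itv /= => /andP[/ltW as_ /ltW sb]; apply: Dphi; apply: Hs; rewrite as_.
  - apply: derivable_within_continuous => s; rewrite in_itv /= => sab.
    by have [] := Dphi s (Hs _ sab).
  rewrite in_itv /= in cab; have sc := seg _ (Hs _ cab).
  rewrite normrM (ger0_norm (_ : 0 <= b - a)) ?subr_ge0 //.
  apply: ler_wpM2r; rewrite ?subr_ge0 //.
  apply: le_trans (He _ (le_lt_trans sc xe)).2 _.
  by apply: ler_wpM2l => //; apply: lerXn2r; rewrite ?nnegrE.
have -> : w x = phi (x j 0) by rewrite /phi /cut subrK.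
have -> : w (cut j x) = phi 0 by rewrite /phi scale0r addr0.
have CX : 0 <= C * `|x| ^+ k by rewrite mulr_ge0 ?exprn_ge0.
rewrite exprSr mulrA.
have [x0|x0] := leP 0 (x j 0).
  apply: le_trans (mvt 0 (x j 0) x0 _) _ => [s /andP[s0 sx]|].
    by rewrite !ger0_norm.
  by rewrite subr0; apply: ler_wpM2l => //; rewrite -(ger0_norm x0) coord_le_norm.
rewrite distrC; apply: le_trans (mvt (x j 0) 0 (ltW x0) _) _ => [s /andP[s0 sx]|].
  by rewrite !ler0_norm ?lerN2 // ltW.
by rewrite sub0r; apply: ler_wpM2l => //; rewrite -(ltr0_norm x0) coord_le_norm.
Unshelve. all: by end_near. Qed.

Definition killY j : 'I_3 -> A := fun i => if i == j then 0 else 'Y_i.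

Lemma ev_killY j p x : ev (subst (killY j) p) x = ev p (cut j x).
Proof.
rewrite ev_subst; congr ev; apply/colP => i; rewrite cutE mxE /killY.
by case: ifP => _; rewrite ?ev0 ?evY.
Qed.

Lemma mderiv_killY j p : 'd_j (subst (killY j) p) = 0.
Proof.
rewrite mderiv_subst big1 // => i _; rewrite /killY; case: eqP => [_|/eqP ij].
  by rewrite mderiv0 mulr0.
by rewrite mderivY (negPf ij) mulr0.
Qed.

Lemma ev_mint_cut j p x : ev (mint j p) (cut j x) = 0.
Proof.
rewrite /ev /mint raddf_sum big1 // => m _; rewrite /= mevalZ mevalX.
by rewrite (bigD1 j) //= cutE eqxx mnmDE mnm1E eqxx addn1 expr0n /= mul0r mulr0.
Qed.

(** The data for one integration along coordinate [j]. Only this direction is involved, so the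
    property survives setting another coordinate to zero. *)
Definition tame k j u := (\forall x \near (0 : V), derivable u x (ebase R j)) /\
  exists G, bigO k (fun x => 'D_(ebase R j) u x - ev G x).

Lemma derive_subE j u q x : derivable u x (ebase R j) ->
  is_derive x (ebase R j) (fun y => u y - ev q y) ('D_(ebase R j) u x - ev ('d_j q) x).
Proof.
move=> Du; have D1 : is_derive x (ebase R j) u ('D_(ebase R j) u x) by apply: DeriveDef.
have D2 := is_derive_ev j q x.
exact: (is_deriveB D1 D2).
Qed.

Lemma bigO_sub_ev k j u q : (\forall x \near (0 : V), derivable u x (ebase R j)) ->
  bigO k (fun x => 'D_(ebase R j) u x - ev ('d_j q) x) ->
  bigO k.+1 (fun x => u (cut j x) - ev q (cut j x)) -> bigO k.+1 (fun x => u x - ev q x).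
Proof.
move=> Du HD Hc; apply: (bigO_integrate _ _ Hc).
  by apply: filterS Du => x Dux; have [] := derive_subE q Dux.
by apply: bigO_near HD; apply: filterS Du => x Dux; have [_ ->] := derive_subE q Dux.
Qed.

(* Integrating one coordinate at a time avoids the symmetry of second derivatives. *)
Lemma tame_reduce k j u : tame k j u ->
  (exists p, bigO k.+1 (fun x => u (cut j x) - ev p x)) ->
  exists p, bigO k.+1 (fun x => u x - ev p x).
Proof.
move=> [Du [G HG]] [p Hp]; exists (mint j G + subst (killY j) p).
apply: (bigO_sub_ev Du).
  by apply: bigO_eq HG => x; rewrite mderivD mderiv_mint mderiv_killY addr0.
apply: bigO_eq (bigO_cut j Hp) => x /=.
by rewrite evD ev_mint_cut add0r ev_killY !cut_idem.
Qed.

Lemma cutD i j x (h : R) : i != j -> cut i (h *: ebase R j + x) = h *: ebase R j + cut i x.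
Proof.
move=> ij; rewrite /cut addrA; congr (_ - _ *: _).
by rewrite !mxE (negPf ij) mulr0 add0r.
Qed.

Lemma tame_cut k i j u : i != j -> tame k j u -> tame k j (fun x => u (cut i x)).
Proof.
move=> ij [Du [G HG]].
have E x : (fun h : R => h^-1 *: (((fun x => u (cut i x)) \o shift x) (h *: ebase R j) - u (cut i x))) =
  (fun h : R => h^-1 *: ((u \o shift (cut i x)) (h *: ebase R j) - u (cut i x))).
  by apply/funext => h; rewrite /= cutD.
split.
  by have := cut_near i Du; apply: filterS => x; rewrite /derivable E.
exists (subst (killY i) G).
apply: bigO_eq (bigO_cut i HG) => x /=.
by rewrite ev_killY /derive E.
Qed.

(** The regularity behind a remainder of order k: iterated partials exist near 0 and those of order
    k are bounded there. *)
Fixpoint smoothk k u : Prop := match k with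
  | O => bigO 0 u
  | S k' => forall j, (\forall x \near (0 : V), derivable u x (ebase R j)) /\
                smoothk k' ('D_(ebase R j) u)
  end.

(** By induction the partial derivatives have Taylor polynomials. Integrating along x reduces to the
    plane x = 0, then along y to the z-axis, then along z to the origin. *)
Lemma taylor k u : smoothk k u -> exists p, bigO k (fun x => u x - ev p x).
Proof.
elim: k u => [|k IH] u /= Hu.
  by exists 0; apply: bigO_eq Hu => x; rewrite ev0 subr0.
have Hj j : tame k j u by have [Du /IH] := Hu j; split.
apply: (tame_reduce (Hj i0)).
have H1 := tame_cut (isT : i0 != i1) (Hj i1).
apply: (tame_reduce H1).
have H2 := tame_cut (isT : i1 != i2) (tame_cut (isT : i0 != i2) (Hj i2)).
apply: (tame_reduce H2).
exists (mpolyC 3 (u 0)); apply: bigO_eq (bigO0 _) => x.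
rewrite evC (_ : cut _ _ = 0) ?subrr //.
by apply/colP => l; elim/forall_ord3: l; rewrite !cutE !mxE.
Qed.

(* The Taylor polynomial [G] of the derivative and ['d_j p] have antiderivatives
   differing by a polynomial [Q] that is O(|x|^(k+1)), so that ['d_j Q] has order k. *)
Lemma taylor_derive k j u p : smoothk k.+1 u -> bigO k.+1 (fun x => u x - ev p x) ->
  bigO k (fun x => 'D_(ebase R j) u x - ev ('d_j p) x).
Proof.
move=> Hu Hp; have [Du /taylor[G HG]] := Hu j.
pose Q := mint j (G - 'd_j p).
have HQ : bigO k.+1 (fun x => u x - ev (p + Q) x).
  apply: (bigO_sub_ev Du).
    by apply: bigO_eq HG => x; rewrite mderivD mderiv_mint evD evB; ring.
  by apply: bigO_eq (bigO_cut j Hp) => x /=; rewrite evD ev_mint_cut addr0.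
have oQ : ord k.+1 Q.
  apply: bigO_ord; apply: bigO_eq (bigOB Hp HQ) => x.
  by rewrite evD; ring.
have := bigO_ev (mderiv_ord (i := j) oQ); rewrite mderiv_mint => HD.
by apply: bigO_eq (bigOD HG HD) => x; rewrite evB; ring.
Qed.

Lemma smoothk_near k u v : (\forall x \near (0 : V), u x = v x) -> smoothk k u -> smoothk k v.
Proof.
elim: k u v => [|k IH] u v /= uv; first exact: bigO_near.
move=> Hu j; have [Du Su] := Hu j.
have uv2 : \forall x \near (0 : V), \forall y \near x, u y = v y by apply: near_join.
split.
  near=> x; apply: near_eq_derivable (_ : derivable u x _); last by near: x.
  by near: x.
apply: IH Su; near=> x; apply: near_eq_derive; by near: x.
Unshelve. all: by end_near. Qed.

Lemma smooth_on_smoothk (U : set V) (F : V -> V) k i : open U -> U 0 -> smooth_on U F ->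
  smoothk k (fun x => F x i 0).
Proof.
move=> oU U0 SF.
have nU : \forall x \near (0 : V), U x by apply: open_nbhs_nbhs.
(* Generalized over iterated partials so that the induction on k can pass to derivatives. *)
suff H s : smoothk k (fun x => iter_partial s F x i 0) by apply: (H [::]).
elim: k s => [|k IH] s /=.
  have [Cs _] := SF s _ U0.
  have Ci : {for 0, continuous (fun x => iter_partial s F x i 0)}.
    exact: (@continuous_comp _ _ _ (iter_partial s F) (fun M : V => M i 0) 0 Cs (@coord_continuous _ _ _ i 0 _)).
  exists (`|iter_partial s F 0 i 0| + 1).
  move/cvgrPdist_lt: Ci => /(_ 1 ltr01); apply: filterS => x Hx.
  rewrite expr0 mulr1 -[X in `|X|](subrK (iter_partial s F 0 i 0)).
  apply: le_trans (ler_normD _ _) _; rewrite addrC lerD2l distrC ltW //.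
move=> j; split.
  apply: filterS nU => x Ux; have [_ /(_ j) Ds] := SF s x Ux.
  exact: ((derivable_mxP _ _ _).1 Ds).
apply: smoothk_near (IH (j :: s)); apply: filterS nU => x Ux.
have [_ /(_ j) Ds] := SF s x Ux.
by rewrite /= (derive_mx Ds) mxE.
Qed.

End Taylor.

(** * Polynomial maps of the space and the inverse of the normal form *)

Section PolynomialMaps.
Context {R : realType}.
Local Notation V := 'cV[R]_3.
Local Notation A := (mpoly 3 R).
Implicit Types (F G : 'I_3 -> A) (x y : V) (p : mpoly 2 R).

Lemma vev_comp F G x : vev (pcomp F G) x = vev F (vev G x).
Proof. by apply/colP => i; rewrite !mxE ev_subst. Qed.

Lemma vev_id x : vev pid x = x.
Proof. by apply/colP => i; rewrite !mxE evY. Qed.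

Lemma continuous_vev F : continuous (vev F).
Proof.
move=> x; apply: (@cvgrPdist_lt _ _ _ (nbhs x) _ (vev F) (vev F x)).2 => e e0.
have e2 : 0 < e / 2 by rewrite divr_gt0.
have H i : \forall y \near x, `|ev (F i) x - ev (F i) y| < e / 2.
  by have /cvgrPdist_lt := @continuous_ev R (F i) x; apply.
have [H0 H1 H2] := And3 (H i0) (H i1) (H i2).
apply: (@filterS3 V (nbhs x) _ _ _ _ _ _ H0 H1 H2) => y y0 y1 y2.
apply: (@le_lt_trans _ _ (e / 2)); last by rewrite ltr_pdivrMr // ltr_pMr // ltr1n.
apply: norm_le_coord => [|i]; first exact: ltW.
by rewrite !mxE ltW //; elim/forall_ord3: i.
Qed.

Lemma derivable_vev F x j : derivable (vev F) x (ebase R j).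
Proof.
apply/derivable_mxP => i k; rewrite (_ : (fun y => _) = ev (F i)); last first.
  by apply/funext => y; rewrite mxE.
by have [] := is_derive_ev j (F i) x.
Qed.

Lemma derive_vev F x j : 'D_(ebase R j) (vev F) x = vev (fun i => 'd_j (F i)) x.
Proof.
rewrite derive_mx; last exact: derivable_vev.
apply/matrixP => i k; rewrite !mxE (_ : (fun y => _) = ev (F i)); last first.
  by apply/funext => y; rewrite mxE.
by have [_ ->] := is_derive_ev j (F i) x.
Qed.

Lemma smooth_vev F : smooth_on setT (vev F).
Proof.
have H s : exists G, iter_partial s (vev F) = vev G.
  elim: s => [|j s [G /= ->]]; first by exists F.
  by exists (fun i => 'd_j (G i)); apply/funext => x; rewrite derive_vev.
move=> s x _; have [G ->] := H s; split; first exact: continuous_vev.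
by move=> j; apply: derivable_vev.
Qed.

Lemma det_Dmat_vev F x : \det (Dmat (vev F) x) = ev (\det (jac F)) x.
Proof.
rewrite /ev -det_map_mx; congr determinant; apply/matrixP => i j.
by rewrite !mxE derive_vev mxE.
Qed.

Lemma mulJE x i : (Jmat *m x) i 0 = tri (x i0 0 + x i1 0) (x i1 0 + x i2 0) (x i2 0) i.
Proof.
rewrite mxE sum_ord3 !mxE.
by elim/forall_ord3: i; rewrite triE /=; ring.
Qed.

Lemma ev_lift2 p x : ev (lift2 p) x = peval2 p (x i0 0) (x i1 0).
Proof.
rewrite /ev subst_meval; apply: meval_eq => i.
by case: ifP => _; apply: mevalXU.
Qed.

Lemma gmapE p : gmap p = vev (Gpol p).
Proof.
apply/funext => x; apply/colP => i; rewrite mulJE !mxE.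
by elim/forall_ord3: i; rewrite /Gpol /Jvec !triE !evD !evY ?ev_lift2 ?ev0 /=; ring.
Qed.

(** If eta = J (xi + e3 p), then J^-1 eta has the same first two coordinates as xi, so p can be
    evaluated there and subtracted. *)
Definition Gpolinv p : 'I_3 -> A :=
  fun i => Jpolinv i - tri 0 0 (subst Jpolinv (lift2 p)) i.

Lemma eq_subst_lift2 F G p : F i0 = G i0 -> F i1 = G i1 ->
  subst F (lift2 p) = subst G (lift2 p).
Proof.
move=> e0 e1; rewrite !subst_subst; apply: eq_subst => i.
by case: ifP => _; rewrite !substY.
Qed.

Lemma GpolinvK p : pcomp (Gpol p) (Gpolinv p) = pid.
Proof.
apply/funext => i; rewrite /pcomp subst_Jvec -[RHS](@sg_tau R) substY.
rewrite (_ : (fun j => _) = Jpolinv); last first.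
  apply/funext => j; rewrite substD substY {1}/Gpolinv -addrA.
  rewrite -[RHS]addr0; congr (_ + _); elim/forall_ord3: j; rewrite !triE ?subst0 ?oppr0 ?addr0 //.
  by rewrite (@eq_subst_lift2 (Gpolinv p) Jpolinv) ?addNr // /Gpolinv triE subr0.
by elim/forall_ord3: i; rewrite /Jvec /Jpolinv !triE !(substD, substN, substY) /Jpol !triE; ring.
Qed.

Lemma GpolK p : pcomp (Gpolinv p) (Gpol p) = pid.
Proof.
have E i : subst (Gpol p) (Jpolinv i) = 'Y_i + tri 0 0 (lift2 p) i.
  rewrite -[RHS](JvecK (fun i => 'Y_i + tri 0 0 (lift2 p) i)) -/(Gpol p).
  by elim/forall_ord3: i; rewrite /Jpolinv /Jvecinv !triE ?(substD, substN, substY).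
apply/funext => i; rewrite /pcomp /Gpolinv substB E -addrA -[RHS]addr0; congr (_ + _).
elim/forall_ord3: i; rewrite !triE ?subst0 ?subrr //.
by rewrite subst_subst (@eq_subst_lift2 _ pid) ?subst_id ?subrr // E triE addr0.
Qed.

Lemma pmap_deg_leP F n : (pmap_deg F <= n)%N <-> forall i, degle n (F i).
Proof.
split=> [/bigmax_leqP H i m mF|H].
  by have /bigmax_leqP_seq := H i isT; apply.
by apply/bigmax_leqP => i _; apply/bigmax_leqP_seq => m mF _; apply: H mF.
Qed.

Lemma homog1_degle n (q : A) : (0 < n)%N -> homog 1 q -> degle n q.
Proof. by move=> n0 Hq m /Hq /eqP->. Qed.

Lemma degle_coeffY n (q : A) i : q@_(mnm1 i) != 0 -> degle n q -> (0 < n)%N.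
Proof. by move=> qi /(_ (mnm1 i)); rewrite mcoeff_msupp mdeg1; apply. Qed.

(** In both maps p occurs up to an invertible linear substitution, which preserves degree bounds,
    and all else is linear. *)
Lemma pmap_deg_Gpolinv p : pmap_deg (Gpolinv p) = pmap_deg (Gpol p).
Proof.
have dY n i : (0 < n)%N -> degle n ('Y_i : A) by move=> n0; apply: supportedY.
have d0 n : degle n (0 : A) by apply: supported0.
apply/eqP; rewrite eqn_leq; apply/andP; split; apply/pmap_deg_leP.
- have /pmap_deg_leP H := leqnn (pmap_deg (Gpol p)).
  move: (pmap_deg _) H => n H.
  (* The coefficient of x in the first component is 1, so n >= 1 and n bounds the degree of the
     linear terms. *)
  have n0 : (0 < n)%N.
    apply: (degle_coeffY (i := i0)) (H i0); rewrite /Gpol /Jvec !triE !mcoeffD !mcoeff0 !mcoeffXU /=.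
    by rewrite !(mulr0n, mulr1n, addr0) oner_eq0.
  have Hp : degle n (lift2 p).
    have := supportedB (H i2) (dY n i2 n0).
    by rewrite /Gpol /Jvec !triE addrC addKr.
  have Jn i : degle n (Jpolinv i : A) by exact: homog1_degle n0 (@homog_Jpolinv R i).
  move=> i; apply: supportedB; first exact: Jn.
  elim/forall_ord3: i; rewrite triE; [exact: d0 | exact: d0 |].
  apply: (degle_subst _ Hp) => j.
  exact: (@homog1_degle 1 _ isT) (@homog_Jpolinv R j).
have /pmap_deg_leP H := leqnn (pmap_deg (Gpolinv p)).
move: (pmap_deg _) H => n H.
have n0 : (0 < n)%N.
  apply: (degle_coeffY (i := i0)) (H i0); rewrite /Gpolinv /Jpolinv !triE !(mcoeffD, mcoeffN) ?mcoeff0 !mcoeffXU /=.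
  by rewrite !(mulr0n, mulr1n, oppr0, addr0, subr0) oner_eq0.
have Hp : degle n (subst Jpolinv (lift2 p)).
  have := supportedB (dY n i2 n0) (H i2).
  by rewrite /Gpolinv /Jpolinv !triE opprB addrC subrK.
have {}Hp : degle n (lift2 p).
  rewrite -(sg_tau (lift2 p)); apply: (degle_subst _ Hp) => j.
  exact: (@homog1_degle 1 _ isT) (@homog_Jpol R j).
move=> i; apply: supported_Jvec => {}i; apply: supportedD; first exact: dY.
by elim/forall_ord3: i; rewrite triE; [exact: d0 | exact: d0 |].
Qed.

End PolynomialMaps.

(** * Functions modulo powers of the norm, and the Taylor polynomial of the map *)

Section Congruence.
Context {R : realType}.
Local Notation V := 'cV[R]_3.
Local Notation A := (mpoly 3 R).
Implicit Types (u v : V -> R) (p : A).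

(** Boundedness is included so that the relation is compatible with products, hence with
    determinants and polynomials. *)
Definition congO k u v := [/\ bigO 0 u, bigO 0 v & bigO k (fun x => u x - v x)].

Lemma congO_eq k u v u' v' : u =1 u' -> v =1 v' -> congO k u v -> congO k u' v'.
Proof.
move=> eu ev_ [Hu Hv Huv]; split; [exact: bigO_eq Hu | exact: bigO_eq Hv |].
by apply: bigO_eq Huv => x; rewrite eu ev_.
Qed.

Lemma congO_cst k (c : R) : congO k (fun=> c) (fun=> c).
Proof.
split; try exact: bigO_cst.
by apply: bigO_eq (bigO0 k) => x; rewrite subrr.
Qed.

Lemma congO_ev k u p : bigO k (fun x => u x - ev p x) -> congO k u (ev p).
Proof.
move=> H; have Hp : bigO 0 (ev p) by apply: bigO_ev.
split => //; apply: bigO_eq (bigOD (bigOW (leq0n k) H) Hp) => x.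
by rewrite subrK.
Qed.

Lemma congOD k u v u' v' : congO k u v -> congO k u' v' ->
  congO k (fun x => u x + u' x) (fun x => v x + v' x).
Proof.
move=> [Hu Hv H] [Hu' Hv' H']; split; try exact: bigOD.
by apply: bigO_eq (bigOD H H') => x; ring.
Qed.

Lemma congOM k u v u' v' : congO k u v -> congO k u' v' ->
  congO k (fun x => u x * u' x) (fun x => v x * v' x).
Proof.
move=> [Hu Hv H] [Hu' Hv' H']; split; try exact: (@bigOM R 0 0).
have H1 := bigOM H Hu'; rewrite addn0 in H1.
by apply: bigO_eq (bigOD H1 (@bigOM R 0 k _ _ Hv H')) => x; ring.
Qed.

Lemma congO_big k (idx : R) (op : R -> R -> R) (I : Type) (r : seq I) (F G : I -> V -> R) :
  (forall u v u' v', congO k u v -> congO k u' v' ->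
    congO k (fun x => op (u x) (u' x)) (fun x => op (v x) (v' x))) ->
  (forall i, congO k (F i) (G i)) ->
  congO k (fun x => \big[op/idx]_(i <- r) F i x) (fun x => \big[op/idx]_(i <- r) G i x).
Proof.
move=> Hop HFG; elim: r => [|i r IH].
  by apply: congO_eq (congO_cst k idx) => x; rewrite big_nil.
by apply: congO_eq (Hop _ _ _ _ (HFG i) IH) => x; rewrite big_cons.
Qed.

Lemma congO_det k (M N : V -> 'M[R]_3) :
  (forall i j, congO k (fun x => M x i j) (fun x => N x i j)) ->
  congO k (fun x => \det (M x)) (fun x => \det (N x)).
Proof.
move=> H; rewrite /determinant; apply: congO_big => [|s]; first exact: congOD.
apply: congOM; first exact: congO_cst.
by apply: congO_big => [|i]; [exact: congOM | exact: H].
Qed.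

Lemma congO_ev_comp k (F G : V -> V) p :
  (forall i, congO k (fun x => F x i 0) (fun x => G x i 0)) ->
  congO k (fun x => ev p (F x)) (fun x => ev p (G x)).
Proof.
move=> H; elim/(@mpoly_ring_ind 3 R): p => [c|i|p q IHp IHq|p q IHp IHq].
- by apply: congO_eq (congO_cst k c) => x; rewrite evC.
- by apply: congO_eq (H i) => x; rewrite evY.
- by apply: congO_eq (congOD IHp IHq) => x; rewrite evD.
- by apply: congO_eq (congOM IHp IHq) => x; rewrite evM.
Qed.

Lemma bigO_at0P (F : V -> V) k :
  bigO_at0 F k <-> forall i, bigO k (fun x => F x i 0).
Proof.
split=> [[C [e e0 H]] i|H].
  exists C; apply/nearP; exists e => // x xe.
  exact: le_trans (coord_le_norm _ _) (H x xe).
have [c0 c00 H0] := bigO_pos (H i0); have [c1 c10 H1] := bigO_pos (H i1).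
have [c2 c20 H2] := bigO_pos (H i2).
suff /nearP[e e0 He] : \forall x \near (0 : V), `|F x| <= (c0 + c1 + c2) * `|x| ^+ k.
  by exists (c0 + c1 + c2), e.
near=> x; apply: norm_le_coord => [|i]; first by rewrite mulr_ge0 ?exprn_ge0 // !addr_ge0.
have G0 : `|F x i0 0| <= c0 * `|x| ^+ k by near: x.
have G1 : `|F x i1 0| <= c1 * `|x| ^+ k by near: x.
have G2 : `|F x i2 0| <= c2 * `|x| ^+ k by near: x.
have X0 : 0 <= `|x| ^+ k by rewrite exprn_ge0.
have N0 := mulr_ge0 c00 X0; have N1 := mulr_ge0 c10 X0; have N2 := mulr_ge0 c20 X0.
rewrite !mulrDl; elim/forall_ord3: i; lra.
Unshelve. all: by end_near. Qed.

Lemma only_deg_ge2_ord (p : mpoly 2 R) : ord 2 p -> only_deg_ge2 p.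
Proof. by move=> Hp m md; apply: (supported_coeff Hp); rewrite -ltnNge. Qed.

Lemma vol_aut_diffeo (P Q : 'I_3 -> A) : vol_aut P Q ->
  diffeo_on setT setT (vev P) (vev Q).
Proof.
move=> [PQ QP _]; split; [exact: openT | exact: openT | by split; apply: smooth_vev | | ].
  by move=> x _; split => //; rewrite -vev_comp QP vev_id.
by move=> x _; split => //; rewrite -vev_comp PQ vev_id.
Qed.

(** Differentiation loses one order, so a remainder of order D + 3 for the map gives order D + 2 for
    det DF - 1. *)
Lemma taylor_map D (f b : V -> V) (U : set V) :
  open U -> U 0 -> smooth_on U f -> (forall x, U x -> \det (Dmat f x) = 1) ->
  (forall x, f x = Jmat *m (x + b x)) -> bigO_at0 b 2 ->
  exists F : 'I_3 -> A, [/\ forall i, bigO D.+3 (fun x => f x i 0 - ev (F i) x),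
    forall i, ord 2 (F i - Jpol i) & ord D.+2 (\det (jac F) - 1)].
Proof.
move=> oU U0 Sf Df fb /bigO_at0P Hb.
have nU : \forall x \near (0 : V), U x by apply: open_nbhs_nbhs.
have Ss i k : smoothk k (fun x => f x i 0) by apply: smooth_on_smoothk oU U0 Sf.
have /choice[F HF] : forall i, exists p, bigO D.+3 (fun x => f x i 0 - ev p x).
  by move=> i; apply: taylor.
exists F; split => //.
  move=> i; apply: bigO_ord.
  have Hbi : bigO 2 (fun x => (Jmat *m b x) i 0).
    apply: (bigO_eq (u := fun x => tri (b x i0 0 + b x i1 0) (b x i1 0 + b x i2 0) (b x i2 0) i)).
      by move=> x; rewrite mulJE.
    by elim/forall_ord3: i; do ?apply: bigOD; apply: Hb.
  apply: bigO_eq (bigOB Hbi (bigOW (isT : 2 <= D.+3)%N (HF i))) => x.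
  rewrite evB fb !mulJE !mxE.
  by elim/forall_ord3: i {Hbi}; rewrite /Jpol !triE ?evD !evY; ring.
apply: bigO_ord.
have K : congO D.+2 (fun x => \det (Dmat f x)) (fun x => \det (Dmat (vev F) x)).
  apply: congO_det => i j.
  apply: (@congO_eq _ (fun x => Dmat f x i j) (ev ('d_j (F i)))) => [//|x|].
    by rewrite mxE derive_vev mxE.
  apply: congO_ev; apply: bigO_near (taylor_derive j (Ss i _) (HF i)).
  apply: filterS nU => x Ux; have [_ /(_ j) Ds] := Sf [::] x Ux.
  by rewrite mxE (derive_mx Ds) mxE.
have [_ _ H] := K; apply: bigO_near (bigON H); apply: filterS nU => x Ux.
by rewrite Df // det_Dmat_vev evB ev1 opprB.
Qed.

End Congruence.

Theorem theorem2 (R : realType) (f b : 'cV[R]_3 -> 'cV[R]_3)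
    (U : set 'cV[R]_3) :
  local_diffeo0 f U ->
  (forall x, U x -> \det (Dmat f x) = 1) ->
  (forall xi, f xi = Jmat *m (xi + b xi)) ->
  bigO_at0 b 2 ->
  (forall D : nat, (2 <= D)%N ->
     exists (psi psiinv : 'cV[R]_3 -> 'cV[R]_3) (U' V' : set 'cV[R]_3)
            (p : mpoly.mpoly 2 R),
       [/\ U' 0 /\ diffeo_on U' V' psi psiinv,
           (forall x, U' x -> \det (Dmat psi x) = 1),
           bigO_at0 (fun xi => psi xi - xi) 2,
           only_deg_ge2 p &
           bigO_at0 (fun eta => psi (f (psiinv eta)) - gmap p eta) D.+1])
  /\
  (forall p : mpoly.mpoly 2 R,
     (forall xi, \det (Dmat (gmap p) xi) = 1) /\
     exists (qg qinv : 'I_3 -> mpoly.mpoly 3 R) (ginv : 'cV[R]_3 -> 'cV[R]_3),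
       [/\ poly_map_rep qg (gmap p), poly_map_rep qinv ginv,
           (forall xi, ginv (gmap p xi) = xi),
           (forall eta, gmap p (ginv eta) = eta) &
           pmap_deg qinv = pmap_deg qg]).
Proof.
move=> [U0 [W [finv [oU _ [Sf _] _ _]]]] Df fb Hb; split; last first.
  move=> p; split=> [x|]; first by rewrite gmapE det_Dmat_vev det_jac_Gpol ev1.
  exists (Gpol p), (Gpolinv p), (vev (Gpolinv p)); split.
  - by move=> x i; rewrite gmapE mxE.
  - by move=> x i; rewrite mxE.
  - by move=> x; rewrite gmapE -vev_comp GpolK vev_id.
  - by move=> x; rewrite gmapE -vev_comp GpolinvK vev_id.
  - exact: pmap_deg_Gpolinv.
(* From here on the degree of the statement is D + 2. *)
case=> [|[|D]] // _.
have [F [HfF HF2 HFdet]] := taylor_map D oU U0 Sf Df fb Hb.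
have [P [Q [p [PQ HP HQ Hp HG]]]] := normal_form_poly HF2 HFdet.
(* Polynomial automorphisms are global, so domain and range are the whole space. *)
exists (vev P), (vev Q), setT, setT, p; split.
- by split; [| exact: vol_aut_diffeo].
- by have [_ _ dP] := PQ; move=> x _; rewrite det_Dmat_vev dP ev1.
- apply/bigO_at0P => i; apply: bigO_eq (bigO_ev (HP i)) => x.
  by rewrite evB evY !mxE.
- exact: only_deg_ge2_ord.
apply/bigO_at0P => i.
have HQ1 j : bigO 1 (fun x => vev Q x j 0).
  have HY := bigO_ev (@ord1Y R j).
  apply: bigO_eq (bigOD (bigOW (isT : 1 <= 2)%N (bigO_ev (HQ j))) HY) => x.
  by rewrite evB subrK mxE.
have [_ _ HPf] : congO D.+3 (fun x => ev (P i) (f x)) (fun x => ev (P i) (vev F x)).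
  apply: congO_ev_comp => j.
  by apply: congO_eq (congO_ev (HfF j)) => [//|x]; rewrite mxE.
(* The error splits into the Taylor remainder of f, carried through P and evaluated at Q, and the
   remainder of the polynomial normal form. *)
apply: bigO_eq (bigOD (bigO_comp HQ1 HPf) (bigO_ev (HG i))) => x.
rewrite evB gmapE !mxE -[ev (pcomp P _ i) x]/(ev (subst (pcomp F Q) (P i)) x) ev_subst vev_comp.
by rewrite subrKA.
Qed.
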